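(* Let $n\ge 2$, $r\ge 1$, $p\mid r$, and let $\xi\in\mathbb{C}$ be a primitive $p$-th root of unity. Let $c$ be a $G(r,1,n)$-conjugation-invariant complex-valued function on the set of reflections of $G(r,1,n)$ such that $c_g=0$ for every reflection $g\in G(r,1,n)\setminus G(r,p,n)$. Let $\tau$ act as the identity on $V$ and on $V^*$, and on $\mathbb{C}[G(r,1,n)]$ as the algebra automorphism with $\tau(S_1)=\xi S_1$, $\tau(S_i)=S_i$ for $2\le i\le n$. Then $\tau$ induces an algebra automorphism of the rational Cherednik algebra $H_c(G(r,1,n))$ and an action of the group $\mathbb{Z}/p\mathbb{Z}=\langle\tau\rangle$ on $H_c(G(r,1,n))$, and $$H_c(G(r,p,n))=(H_c(G(r,1,n)))^{\mathbb{Z}/p\mathbb{Z}}.$$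
   Context: $V=\mathbb{C}^n$. $G(r,1,n)\subset U(V)$ is the group of monomial $n\times n$ matrices whose nonzero entries are $r$-th roots of unity, generated by $S_1=\mathrm{diag}(e^{2\pi i/r},1,\dots,1)$ and the permutation matrices $S_i$ of the transpositions $(i-1,i)$, $2\le i\le n$. $G(r,p,n)$ is the subgroup of index $p$ generated by $S_1^p$, $S_1^{-1}S_2S_1$, $S_2,\dots,S_n$. For a finite complex reflection group $W\subset U(V)$, let $\mathcal{A}$ be the set of reflection hyperplanes; for $H\in\mathcal{A}$ let $W_H$ be the pointwise stabilizer of $H$ in $W$ (a cyclic group), let $v_H$ be a normal vector of $H$, and let $\alpha_H\in V^*$ be the linear form defining $H$ dual to $v_H$ under the $W$-invariant inner product. Given a $W$-invariant function $c$ on the reflections of $W$, put $\gamma_H=\sum_{g\in W_H\setminus\{1\}}c_g\, g$. The rational Cherednik algebra $H_c(W)$ is the $\mathbb{C}$-algebra generated by $x\in V^*$, $y\in V$, $w\in W$ (with the linear relations of $V$, $V^*$ and the relations of $W$) subject to $$[x,x']=0,\quad [y,y']=0,\quad wxw^{-1}=w(x),\quad wyw^{-1}=w(y),$$ $$[y,x]=\langle y,x\rangle+\sum_{H\in\mathcal{A}}\frac{\langle\alpha_H,y\rangle\langle x,v_H\rangle}{\langle\alpha_H,v_H\rangle}\gamma_H .$$ $H_c(G(r,p,n))$ is formed with $c$ restricted to the reflections of $G(r,p,n)$, and is regarded as the subalgebra of $H_c(G(r,1,n))$ generated by $V$, $V^*$ and $G(r,p,n)$. *)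

(* Defs.v *)
From HB Require Import structures.
From mathcomp Require Import all_boot all_order all_fingroup all_algebra.
From mathcomp Require Import generic_quotient finmap.
From mathcomp Require Import all_classical reals trigo.
From mathcomp Require Import complex monalg.

Set Implicit Arguments.
Unset Strict Implicit.
Unset Printing Implicit Defensive.

Import Order.TTheory GRing.Theory Num.Theory.
Local Open Scope classical_set_scope.
Local Open Scope ring_scope.

(** Quotient of an algebra by the two-sided ideal generated by a set.  Such a
    quotient may be the zero ring, and [lalgType]/[algType] exclude the zero
    ring; hence the quotient is equipped with [pzRingType] and [lmodType]
    structures, the compatibility of products and scalars being given by the
    lemmas [quot_alg_scalerAl] and [quot_alg_scalerAr]. *)

Definition two_sided_ideal (A : pzRingType) (I : set A) : Prop :=
  [/\ I 0, forall u v, I u -> I v -> I (u + v)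
    & forall a u b, I u -> I (a * u * b)].

Definition ideal_gen (A : pzRingType) (S : set A) : set A :=
  smallest (@two_sided_ideal A) S.

Section QuotientAlgebra.
Variables (K : comNzRingType) (A : algType K) (S : set A).
Local Open Scope quotient_scope.

Lemma ideal_gen_ideal : two_sided_ideal (ideal_gen S).
Proof.
split=> [I [[]]//|u v Iu Iv I II|a u b Iu I II].
- by case: (II) => -[_ ID _] _; apply: ID; [apply: Iu|apply: Iv].
- by case: (II) => -[_ _ IM] _; apply: IM; apply: Iu.
Qed.

Lemma ideal_gen0 : ideal_gen S 0. Proof. by have [] := ideal_gen_ideal. Qed.

Lemma ideal_genD u v : ideal_gen S u -> ideal_gen S v -> ideal_gen S (u + v).
Proof. by have [_ + _] := ideal_gen_ideal; apply. Qed.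

Lemma ideal_genMl a u : ideal_gen S u -> ideal_gen S (a * u).
Proof. by have [_ _ /(_ a u 1)] := ideal_gen_ideal; rewrite mulr1. Qed.

Lemma ideal_genMr u b : ideal_gen S u -> ideal_gen S (u * b).
Proof. by have [_ _ /(_ 1 u b)] := ideal_gen_ideal; rewrite mul1r. Qed.

Lemma ideal_genN u : ideal_gen S u -> ideal_gen S (- u).
Proof. by rewrite -mulN1r; apply: ideal_genMl. Qed.

Definition ideal_equiv (u v : A) : bool := `[< ideal_gen S (u - v) >].

Lemma ideal_equiv_is_equiv : equiv_class_of ideal_equiv.
Proof.
split=> [u|u v|v u w]; rewrite /ideal_equiv.
- by apply/asboolP; rewrite subrr; apply: ideal_gen0.
- by apply: asbool_equiv_eq; split=> /ideal_genN; rewrite opprB.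
- move=> /asboolP uv /asboolP vw; apply/asboolP.
  by rewrite -(subrK v u) -addrA; apply: ideal_genD.
Qed.

Canonical ideal_equiv_equiv := EquivRelPack ideal_equiv_is_equiv.
Canonical ideal_equiv_encModRel := defaultEncModRel ideal_equiv.

Definition quot_alg : Type := {eq_quot ideal_equiv}.

HB.instance Definition _ : EqQuotient A ideal_equiv quot_alg :=
  EqQuotient.on quot_alg.
HB.instance Definition _ := Choice.on quot_alg.

Definition quot_pi (u : A) : quot_alg := \pi_quot_alg u.
Definition quot_repr (x : quot_alg) : A := repr x.

Lemma quot_reprK : cancel quot_repr quot_pi.
Proof. exact: reprK. Qed.

Lemma quot_algP u v : quot_pi u = quot_pi v <-> ideal_gen S (u - v).
Proof. by split=> [/eqmodP/asboolP|uv]//; apply/eqmodP/asboolP. Qed.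

Definition quot_zero : quot_alg := quot_pi 0.
Definition quot_one : quot_alg := quot_pi 1.
Definition quot_opp (x : quot_alg) : quot_alg := quot_pi (- quot_repr x).
Definition quot_add (x y : quot_alg) : quot_alg :=
  quot_pi (quot_repr x + quot_repr y).
Definition quot_mul (x y : quot_alg) : quot_alg :=
  quot_pi (quot_repr x * quot_repr y).
Definition quot_scale (k : K) (x : quot_alg) : quot_alg :=
  quot_pi (k *: quot_repr x).

Lemma repr_pi u : ideal_gen S (quot_repr (quot_pi u) - u).
Proof. by apply/quot_algP; rewrite quot_reprK. Qed.

Lemma pi_quot_opp u : quot_opp (quot_pi u) = quot_pi (- u).
Proof. by apply/quot_algP; rewrite -opprD; exact: (ideal_genN (repr_pi u)). Qed.

Lemma pi_quot_add u v : quot_add (quot_pi u) (quot_pi v) = quot_pi (u + v).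
Proof.
apply/quot_algP; rewrite opprD addrACA.
exact: (ideal_genD (repr_pi u) (repr_pi v)).
Qed.

Lemma pi_quot_mul u v : quot_mul (quot_pi u) (quot_pi v) = quot_pi (u * v).
Proof.
apply/quot_algP; set u' := quot_repr _; set v' := quot_repr _.
rewrite -[X in ideal_gen _ X](subrKA (u * v')) -mulrBl -mulrBr.
exact: (ideal_genD (ideal_genMr v' (repr_pi u)) (ideal_genMl u (repr_pi v))).
Qed.

Lemma pi_quot_scale k u : quot_scale k (quot_pi u) = quot_pi (k *: u).
Proof.
apply/quot_algP; rewrite -scalerBr -[X in k *: X]mul1r scalerAl.
exact: (ideal_genMl _ (repr_pi u)).
Qed.

Let piE := (pi_quot_opp, pi_quot_add, pi_quot_mul, pi_quot_scale).

Lemma quot_addA : associative quot_add.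
Proof.
by move=> x y z; rewrite -[x]quot_reprK -[y]quot_reprK -[z]quot_reprK !piE addrA.
Qed.

Lemma quot_addC : commutative quot_add.
Proof. by move=> x y; rewrite -[x]quot_reprK -[y]quot_reprK !piE addrC. Qed.

Lemma quot_add0 : left_id quot_zero quot_add.
Proof. by move=> x; rewrite -[x]quot_reprK !piE add0r. Qed.

Lemma quot_addN : left_inverse quot_zero quot_opp quot_add.
Proof. by move=> x; rewrite -[x]quot_reprK !piE addNr. Qed.

HB.instance Definition _ :=
  GRing.isZmodule.Build quot_alg quot_addA quot_addC quot_add0 quot_addN.

Lemma quot_mulA : associative quot_mul.
Proof.
by move=> x y z; rewrite -[x]quot_reprK -[y]quot_reprK -[z]quot_reprK !piE mulrA.
Qed.

Lemma quot_mul1 : left_id quot_one quot_mul.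
Proof. by move=> x; rewrite -[x]quot_reprK !piE mul1r. Qed.

Lemma quot_mulr1 : right_id quot_one quot_mul.
Proof. by move=> x; rewrite -[x]quot_reprK !piE mulr1. Qed.

Lemma quot_mulDl : left_distributive quot_mul +%R.
Proof.
move=> x y z; rewrite -[x]quot_reprK -[y]quot_reprK -[z]quot_reprK.
by rewrite /GRing.add /= !piE mulrDl.
Qed.

Lemma quot_mulDr : right_distributive quot_mul +%R.
Proof.
move=> x y z; rewrite -[x]quot_reprK -[y]quot_reprK -[z]quot_reprK.
by rewrite /GRing.add /= !piE mulrDr.
Qed.

HB.instance Definition _ := GRing.Zmodule_isPzRing.Build quot_alg
  quot_mulA quot_mul1 quot_mulr1 quot_mulDl quot_mulDr.

Lemma quot_scaleA a b x : quot_scale a (quot_scale b x) = quot_scale (a * b) x.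
Proof. by rewrite -[x]quot_reprK !piE scalerA. Qed.

Lemma quot_scale1 : left_id 1 quot_scale.
Proof. by move=> x; rewrite -[x]quot_reprK !piE scale1r. Qed.

Lemma quot_scaleDr : right_distributive quot_scale +%R.
Proof.
move=> a x y; rewrite -[x]quot_reprK -[y]quot_reprK.
by rewrite /GRing.add /= !piE scalerDr.
Qed.

Lemma quot_scaleDl x : {morph quot_scale^~ x : a b / a + b}.
Proof.
by move=> a b; rewrite -[x]quot_reprK [RHS]/GRing.add /= !piE scalerDl.
Qed.

HB.instance Definition _ := GRing.Zmodule_isLmodule.Build K quot_alg
  quot_scaleA quot_scale1 quot_scaleDr quot_scaleDl.

Lemma quot_alg_scalerAl (k : K) (x y : quot_alg) : k *: (x * y) = (k *: x) * y.
Proof.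
rewrite -[x]quot_reprK -[y]quot_reprK /GRing.scale /GRing.mul /= !piE.
by rewrite scalerAl.
Qed.

Lemma quot_alg_scalerAr (k : K) (x y : quot_alg) : k *: (x * y) = x * (k *: y).
Proof.
rewrite -[x]quot_reprK -[y]quot_reprK /GRing.scale /GRing.mul /= !piE.
by rewrite scalerAr.
Qed.

(** Unital subalgebra generated by a set. *)
Definition is_subalg (B : set quot_alg) : Prop :=
  [/\ B 1, forall (k : K) u v, B u -> B v -> B (k *: u + v)
    & forall u v, B u -> B v -> B (u * v)].

Definition subalg_gen (X : set quot_alg) : set quot_alg :=
  smallest is_subalg X.

End QuotientAlgebra.

Definition alg_morphism (K : comNzRingType) (A B : algType K) (S : set A)
    (T : set B) (f : quot_alg S -> quot_alg T) : Prop :=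
  linear f /\ monoid_morphism f.

(** The free associative algebra on [X]: the monoid algebra of the free
    monoid on [X]. *)

Definition free_alg (K : comNzRingType) (X : choiceType) : Type :=
  {malg K[{fmonom X}]}.

Section FreeAlgebra.
Variables (K : comNzRingType) (X : choiceType).

HB.instance Definition _ := GRing.Lalgebra.on (free_alg K X).

Lemma free_alg_scalerAr (k : K) (u v : free_alg K X) :
  k *: (u * v) = u * (k *: v).
Proof.
apply/malgP=> m; rewrite mcoeffZ.
rewrite (mcoeffMlw m (fsubset_refl _) (msuppZ_le k v)) mcoeffMl big_distrr /=.
apply: eq_bigr => i _; rewrite big_distrr /=; apply: eq_bigr => j _.
by rewrite mcoeffZ mulrnAr mulrCA.
Qed.

HB.instance Definition _ :=
  GRing.Lalgebra_isAlgebra.Build K (free_alg K X) free_alg_scalerAr.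

Definition free_gen (a : X) : free_alg K X := << fmu a >>.

End FreeAlgebra.

(** Elements of [V = C^n] are columns, elements of [V^*] are rows.  A group [W]
    of matrices acts on [V] by [y |-> w *m y], hence on [V^*] by
    [x |-> x *m invmx w].  The invariant inner product is the standard
    Hermitian product, since [W] consists of unitary matrices. *)

Section Reflections.
Variables (R : realType) (n : nat).
Local Notation C := R[i].
Implicit Types (W : set 'M[C]_n) (H : set 'cV[C]_n).

Definition pairing (x : 'rV[C]_n) (y : 'cV[C]_n) : C := (x *m y) 0 0.

Definition dual_form (v : 'cV[C]_n) : 'rV[C]_n := (map_mx Num.conj v)^T.

Definition reflections W : set 'M[C]_n :=
  [set g | W g /\ \rank (g - 1%:M) = 1%N].

Definition fixed_space (g : 'M[C]_n) : set 'cV[C]_n := [set y | g *m y = y].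

Definition hyperplanes W : set (set 'cV[C]_n) := fixed_space @` reflections W.

(** A normal vector is chosen once and for all; it only enters the relations
    below through expressions that do not depend on its scaling. *)
Definition normal_vector H : 'cV[C]_n :=
  xget 0 [set v | v != 0 /\ forall y, H y -> pairing (dual_form v) y = 0].

Definition hyperplane_form H : 'rV[C]_n := dual_form (normal_vector H).

Definition stabilizer W H : set W :=
  [set g | forall y, H y -> set_val g *m y = y].

End Reflections.

Section Cherednik.
Variables (R : realType) (n : nat).
Local Notation C := R[i].
Variables (W : set 'M[C]_n) (c : 'M[C]_n -> C).

Definition cherednik_free : algType C :=
  free_alg C ('rV[C]_n + 'cV[C]_n + W)%type.
Local Notation F := cherednik_free.

Definition free_x (x : 'rV[C]_n) : F := free_gen C (inl (inl x)).
Definition free_y (y : 'cV[C]_n) : F := free_gen C (inl (inr y)).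
Definition free_w (w : W) : F := free_gen C (inr w).

Definition gamma (H : set 'cV[C]_n) : F :=
  \sum_(g \in [set g : W | stabilizer H g /\ set_val g <> 1%:M])
    c (set_val g) *: free_w g.

(** Each constructor [u - v] imposes the relation [u = v]. *)
Inductive cherednik_rel : F -> Prop :=
| rel_xP k x x' :
    cherednik_rel (free_x (k *: x + x') - (k *: free_x x + free_x x'))
| rel_yP k y y' :
    cherednik_rel (free_y (k *: y + y') - (k *: free_y y + free_y y'))
| rel_w1 (w : W) : set_val w = 1%:M -> cherednik_rel (free_w w - 1)
| rel_wM (w1 w2 w : W) : set_val w = set_val w1 *m set_val w2 ->
    cherednik_rel (free_w w - free_w w1 * free_w w2)
| rel_xx x x' : cherednik_rel (free_x x * free_x x' - free_x x' * free_x x)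
| rel_yy y y' : cherednik_rel (free_y y * free_y y' - free_y y' * free_y y)
| rel_wx (w w' : W) x : set_val w *m set_val w' = 1%:M ->
    cherednik_rel
      (free_w w * free_x x * free_w w' - free_x (x *m invmx (set_val w)))
| rel_wy (w w' : W) y : set_val w *m set_val w' = 1%:M ->
    cherednik_rel
      (free_w w * free_y y * free_w w' - free_y (set_val w *m y))
| rel_yx y x :
    cherednik_rel
      ((free_y y * free_x x - free_x x * free_y y)
       - ((pairing x y)%:A
          + \sum_(H \in hyperplanes W)
              (pairing (hyperplane_form H) y * pairing x (normal_vector H)
               / pairing (hyperplane_form H) (normal_vector H)) *: gamma H)).

Definition cherednik := quot_alg cherednik_rel.

Definition ch_x (x : 'rV[C]_n) : cherednik := quot_pi cherednik_rel (free_x x).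
Definition ch_y (y : 'cV[C]_n) : cherednik := quot_pi cherednik_rel (free_y y).
Definition ch_w (w : W) : cherednik := quot_pi cherednik_rel (free_w w).

End Cherednik.

Section ImprimitiveGroups.
Variables (R : realType) (r p n : nat).
Local Notation C := R[i].

Definition monomial (g : 'M[C]_n) : Prop :=
  (forall i, exists! j, g i j != 0) /\ (forall j, exists! i, g i j != 0).

Definition Gr1n : set 'M[C]_n :=
  [set g | monomial g /\ forall i j, g i j != 0 -> g i j ^+ r = 1].

(** e^{2 pi i / r} *)
Definition zeta : C :=
  (cos (2 * pi / r%:R : R) +i* sin (2 * pi / r%:R : R))%C.

Definition S1 : 'M[C]_n :=
  diag_mx (\row_(j < n) if (j : nat) == 0%N then zeta else 1).

(** With indices starting at 0, [Strans i] (for [i != 0]) is the matrix of the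
    transposition of [i.-1] and [i]: it is [S_{i+1}] in the numbering
    S_1, ..., S_n of the generators. *)
Definition Strans (i : 'I_n) : 'M[C]_n := tperm_mx (ord_pred i) i.

Definition is_subgroup (G : set 'M[C]_n) : Prop :=
  [/\ G 1%:M, forall g h, G g -> G h -> G (g *m h)
    & forall g, G g -> G (invmx g)].

Definition Grpn : set 'M[C]_n :=
  smallest is_subgroup
    ([set S1 ^+ p]
     `|` [set invmx S1 *m Strans i *m S1 | i in [set i : 'I_n | i = 1%N :> nat]]
     `|` [set Strans i | i in [set i : 'I_n | (0 < i)%N]]).

Lemma Gr1nP g : (0 < r)%N -> Gr1n g <-> exists (s : 'S_n) (d : 'I_n -> C),
  (forall i, d i ^+ r = 1) /\ forall i j, g i j = d i *+ (s i == j).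
Proof.
move=> r0; split=> [[[rows cols] gr]|[s [d [dr gE]]]].
  have /choice[f fP] : forall i, exists j, g i j != 0.
    by move=> i; have [j []] := rows i; exists j.
  have finj : injective f.
    move=> i i' ff; have [k [_ kP]] := cols (f i).
    by rewrite -(kP i (fP i)); apply: kP; rewrite ff.
  exists (perm finj), (fun i => g i (f i)); split=> [i|i j].
    exact: gr.
  rewrite permE; case: eqP => [<-//|fij]; apply/eqP; apply: contra_notT fij.
  by move=> gij; have [k [_ kP]] := rows i; rewrite -(kP _ gij); apply/esym/kP.
have d0 i : d i != 0.
  apply/eqP=> di; have := dr i; rewrite di expr0n gtn_eqF//.
  by move/eqP; rewrite eq_sym oner_eq0.
have gn0 i j : (g i j != 0) = (s i == j).
  by rewrite gE; case: (s i == j); rewrite ?mulr1n ?d0 ?mulr0n ?eqxx.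
split; first split=> [i|j].
- exists (s i); split=> [|j]; first by rewrite gn0.
  by rewrite gn0 => /eqP.
- exists ((s^-1)%g j); split=> [|i]; first by rewrite gn0 permKV.
  by rewrite gn0 => /eqP <-; rewrite permK.
- by move=> i j; rewrite gn0 gE => ->; rewrite mulr1n.
Qed.

Lemma Gr1n_subgroup : (0 < r)%N -> is_subgroup Gr1n.
Proof.
move=> r0; split.
- apply/Gr1nP => //; exists 1%g, (fun=> 1); split=> [i|i j].
    by rewrite expr1n.
  by rewrite mxE perm1.
- move=> g h /Gr1nP-/(_ r0)[s [d [dr gE]]] /Gr1nP-/(_ r0)[s' [d' [dr' hE]]].
  apply/Gr1nP => //; exists (s * s')%g, (fun i => d i * d' (s i)).
  split=> [i|i j]; first by rewrite exprMn dr dr' mulr1.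
  rewrite mxE (bigD1 (s i))//= big1 => [|k ki].
    by rewrite addr0 gE hE eqxx mulr1n permM mulrnAr.
  by rewrite gE eq_sym (negbTE ki) mulr0n mul0r.
- move=> g /Gr1nP-/(_ r0)[s [d [dr gE]]].
  have d0 i : d i != 0.
    apply/eqP=> di; have := dr i; rewrite di expr0n gtn_eqF//.
    by move/eqP; rewrite eq_sym oner_eq0.
  pose h : 'M[C]_n := \matrix_(i, j) ((d ((s^-1)%g i))^-1 *+ ((s^-1)%g i == j)).
  have gh : g *m h = 1%:M.
    apply/matrixP=> i j; rewrite !mxE (bigD1 (s i))//= big1 => [|k ki].
      by rewrite addr0 gE eqxx mulr1n mxE permK mulrnAr divff.
    by rewrite gE eq_sym (negbTE ki) mulr0n mul0r.
  have [gu _] := mulmx1_unit gh.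
  have -> : invmx g = h by rewrite -[h]mul1mx -(mulVmx gu) -mulmxA gh mulmx1.
  apply/Gr1nP => //; exists (s^-1)%g, (fun i => (d ((s^-1)%g i))^-1).
  by split=> [i|i j]; [rewrite exprVn dr invr1|rewrite mxE].
Qed.

Lemma zetaX k : zeta ^+ k =
  (cos (k%:R * (2 * pi / r%:R) : R) +i* sin (k%:R * (2 * pi / r%:R) : R))%C.
Proof.
elim: k => [|k IH]; first by rewrite expr0 !mul0r cos0 sin0.
rewrite exprSr IH /zeta; set t := 2 * pi / r%:R.
have -> : k.+1%:R * t = k%:R * t + t by rewrite -natr1 mulrDl mul1r.
rewrite cosD sinD.
apply/eqP; rewrite eq_complex /=; apply/andP.
by split; apply/eqP; rewrite // addrC.
Qed.

Lemma S1_Gr1n : (0 < r)%N -> Gr1n S1.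
Proof.
move=> r0; apply/Gr1nP => //; exists 1%g.
exists (fun j => if (j : nat) == 0%N then zeta else 1); split=> [i|i j].
  case: ifP => _; last by rewrite expr1n.
  rewrite zetaX mulrCA divff ?pnatr_eq0 -?lt0n// mulr1 mulr_natl.
  by rewrite cos2pi sin2pi.
by rewrite !mxE perm1.
Qed.

Lemma Strans_Gr1n i : (0 < r)%N -> Gr1n (Strans i).
Proof.
move=> r0; apply/Gr1nP => //; exists (tperm (ord_pred i) i), (fun=> 1).
by split=> [j|j k]; [rewrite expr1n|rewrite !mxE].
Qed.

Lemma Grpn_sub : (0 < r)%N -> Grpn `<=` Gr1n.
Proof.
move=> r0; have [G1 GM GV] := Gr1n_subgroup r0.
have GS := S1_Gr1n r0; have GT i := Strans_Gr1n i r0.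
apply: smallest_sub => // g [[->|[i _ <-]]|[i _ <-]] //.
- by elim: p => [|k IH]; [rewrite expr0|rewrite exprS; apply: GM].
- by apply: (GM); [apply: (GM)|] => //; apply: GV.
Qed.

End ImprimitiveGroups.

Arguments Gr1n R r n _ : clear implicits.
Arguments Grpn R r p n _ : clear implicits.
Arguments S1_Gr1n R {r} n _.
Arguments Strans_Gr1n R {r n} i _.

Definition elt (T : choiceType) (W : set T) (g : T) (Wg : W g) : W :=
  exist _ g (mem_set Wg).

Section SubCherednik.
Variables (R : realType) (r p n : nat) (c : 'M[R[i]]_n -> R[i]).
Local Notation G := (Gr1n R r n).
Local Notation Gp := (Grpn R r p n).

Definition Grpn_incl (r_gt0 : (0 < r)%N) (w : Gp) : G :=
  elt (Grpn_sub r_gt0 (set_mem (valP w))).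

(** The subalgebra of [H_c(G(r,1,n))] generated by V, V^* and G(r,p,n). *)
Definition cherednik_sub : set (cherednik G c) :=
  subalg_gen (range (ch_x G c) `|` range (ch_y G c)
              `|` [set ch_w c w | w in [set w : G | Gp (set_val w)]]).

(** [iota] identifies [H_c(G(r,p,n))], defined by generators and relations,
    with this subalgebra. *)
Definition identifies_sub (r_gt0 : (0 < r)%N)
    (iota : cherednik Gp c -> cherednik G c) : Prop :=
  [/\ alg_morphism iota, injective iota, range iota = cherednik_sub
    & [/\ forall x, iota (ch_x Gp c x) = ch_x G c x,
          forall y, iota (ch_y Gp c y) = ch_y G c y
        & forall w, iota (ch_w c w) = ch_w c (Grpn_incl r_gt0 w)]].

End SubCherednik.

Arguments cherednik_sub {R} r p {n} c _.
Arguments identifies_sub {R r p n c} r_gt0 iota.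

(* Main.v *)
(** [G(r,p,n)] is the kernel in [G = G(r,1,n)] of the character [chi] with
    [chi S1 = xi] that kills the permutation matrices, and [tau] multiplies [g]
    by [chi g].  It respects the commutation relation of [y] and [x]: once
    rewritten as one sum over reflections [g], that relation involves [g] only
    through [c g *: g], and [c g = 0] unless [chi g = 1].

    No PBW theorem is needed to embed [Hp = H_c(G(r,p,n))] into
    [H = H_c(G)]: with the coset representatives [S1 ^+ i], [i < p], the
    algebra [H] acts on the induced module, which gives a morphism from [H] to
    [p * p] matrices over [Hp] whose composite with [Hp -> H] has first row
    [(u, 0, ..., 0)] at [u].

    Every product of generators of [H] can be written [b * g] with [b] in the
    subalgebra and [g] in [G]; averaging it over the powers of [tau] gives [0]
    when [chi g != 1], and [b * g], which lies in the subalgebra, otherwise. *)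

From HB Require Import structures.
Require Import Defs.
From mathcomp Require Import all_boot all_order all_fingroup all_algebra.
From mathcomp Require Import finmap ring lra.
From mathcomp Require Import all_classical reals trigo.
From mathcomp Require Import complex monalg.

Set Implicit Arguments.
Unset Strict Implicit.
Unset Printing Implicit Defensive.

Import Order.TTheory GRing.Theory Num.Theory.
Local Open Scope classical_set_scope.
Local Open Scope ring_scope.

(** * Quotient and free algebras *)

Section QuotientMorphisms.
Variables (K : comNzRingType) (A : algType K) (S : set A).

Lemma quot_pi_zmod_morphism : zmod_morphism (quot_pi S).
Proof. by move=> u v; rewrite -pi_quot_add -pi_quot_opp. Qed.

HB.instance Definition _ :=
  GRing.isZmodMorphism.Build A (quot_alg S) (quot_pi S) quot_pi_zmod_morphism.

Lemma quot_pi_monoid_morphism : monoid_morphism (quot_pi S).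
Proof. by split=> // u v; rewrite -pi_quot_mul. Qed.

HB.instance Definition _ :=
  GRing.isMonoidMorphism.Build A (quot_alg S) (quot_pi S)
    quot_pi_monoid_morphism.

Lemma quot_piZ k u : quot_pi S (k *: u) = k *: quot_pi S u.
Proof. by rewrite -pi_quot_scale. Qed.

Lemma quot_pi_eq u v : S (u - v) -> quot_pi S u = quot_pi S v.
Proof. by move=> Suv; apply/quot_algP => I [_]; apply. Qed.

(** The quotient may be the zero ring, hence not an [algType]; its scalars are recorded instead as a
    ring morphism from [K] with central image. *)
Definition quot_const (k : K) : quot_alg S := k *: (1 : quot_alg S).

Lemma quot_constM k x : quot_const k * x = k *: x.
Proof. by rewrite /quot_const -quot_alg_scalerAl mul1r. Qed.

Lemma quot_constC k x : quot_const k * x = x * quot_const k.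
Proof. by rewrite quot_constM /quot_const -quot_alg_scalerAr mulr1. Qed.

Lemma quot_const_zmod_morphism : zmod_morphism quot_const.
Proof. by move=> k l; rewrite /quot_const scalerBl. Qed.

HB.instance Definition _ :=
  GRing.isZmodMorphism.Build K (quot_alg S) quot_const quot_const_zmod_morphism.

Lemma quot_const_monoid_morphism : monoid_morphism quot_const.
Proof.
split=> [|k l]; first exact: scale1r.
by rewrite quot_constM /quot_const scalerA.
Qed.

HB.instance Definition _ :=
  GRing.isMonoidMorphism.Build K (quot_alg S) quot_const
    quot_const_monoid_morphism.

Section Lift.
Variables (B : pzRingType) (phi : {rmorphism A -> B}).
Hypothesis phi0 : forall s, S s -> phi s = 0.

(** The proof that [phi] kills [S] is an argument, so that the morphism structures below can be
    attached to the term. *)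
Definition quot_lift (_ : forall s, S s -> phi s = 0) (x : quot_alg S) : B :=
  phi (quot_repr x).

Lemma quot_liftE u : quot_lift phi0 (quot_pi S u) = phi u.
Proof.
apply/eqP; rewrite -subr_eq0 -rmorphB; apply/eqP.
(* The kernel of [phi] is a two-sided ideal containing [S], hence contains the ideal generated by
   [S]. *)
have := repr_pi (S := S) u; move/(_ [set v | phi v = 0]); apply; split=> // {u}.
split=> [|u v u0 v0|a u b u0] /=; first exact: rmorph0.
  by rewrite rmorphD u0 v0 addr0.
by rewrite !rmorphM u0 mulr0 mul0r.
Qed.

Lemma quot_lift_zmod_morphism : zmod_morphism (quot_lift phi0).
Proof.
by move=> x y; rewrite -[x]quot_reprK -[y]quot_reprK -rmorphB !quot_liftE rmorphB.
Qed.

Lemma quot_lift_monoid_morphism : monoid_morphism (quot_lift phi0).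
Proof.
split=> [|x y]; first by rewrite -(rmorph1 (quot_pi S)) quot_liftE rmorph1.
by rewrite -[x]quot_reprK -[y]quot_reprK -rmorphM !quot_liftE rmorphM.
Qed.

HB.instance Definition _ :=
  GRing.isZmodMorphism.Build (quot_alg S) B (quot_lift phi0)
    quot_lift_zmod_morphism.
HB.instance Definition _ :=
  GRing.isMonoidMorphism.Build (quot_alg S) B (quot_lift phi0)
    quot_lift_monoid_morphism.

End Lift.

Lemma is_subalg0 (B : set (quot_alg S)) : is_subalg B -> B 0.
Proof. by case=> B1 BD _; rewrite -(addNr 1) -scaleN1r; apply: BD. Qed.

Lemma is_subalgZ (B : set (quot_alg S)) k u : is_subalg B -> B u -> B (k *: u).
Proof.
by move=> Bs Bu; rewrite -[_ *: _]addr0; have [_ + _] := Bs; apply=> //;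
  apply: is_subalg0.
Qed.

Lemma subalg_gen_is_subalg (X : set (quot_alg S)) : is_subalg (subalg_gen X).
Proof.
split=> [B [[]]//|k u v Xu Xv B BP|u v Xu Xv B BP].
- by have [[_ BD _] _] := BP; apply: BD; [apply: Xu|apply: Xv].
- by have [[_ _ BM] _] := BP; apply: BM; [apply: Xu|apply: Xv].
Qed.

Lemma subalg_genX (X : set (quot_alg S)) : X `<=` subalg_gen X.
Proof. by move=> x Xx B [_]; apply. Qed.

End QuotientMorphisms.

(** * Monomials and evaluation in the free algebra *)

Section FreeAlgebraMorphisms.
Variables (K : comNzRingType) (X : choiceType).
Local Notation F := (free_alg K X).

Lemma free_genM (m1 m2 : {fmonom X}) :
  (<< mmul m1 m2 >> : F) = (<< m1 >> : F) * (<< m2 >> : F).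
Proof.
rewrite [RHS](@malgMEw _ _ _ _ (<< m1 >> : F) (<< m2 >> : F) msuppU_le msuppU_le).
by rewrite !big_seq_fset1 !mcoeffUU mulr1.
Qed.

Lemma prod_free_gen (m : {fmonom X}) :
  (<< m >> : F) = \prod_(a <- m) free_gen K a.
Proof.
case: m => s /=; elim: s => [|a s IH].
  by rewrite big_nil -fmoneE.
by rewrite big_cons -IH /free_gen -free_genM; congr << _ >>;
  apply: val_inj; rewrite /= fmM fmU.
Qed.

Lemma free_algE (u : F) :
  u = \sum_(m <- msupp u) u@_m *: \prod_(a <- m) free_gen K a.
Proof.
rewrite [LHS](@monalgE _ K); apply: eq_bigr => m _.
rewrite -prod_free_gen; apply/malgP => m'.
by rewrite (mcoeffZ u@_m) !mcoeffU mulrnAr mulr1.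
Qed.

(** Monomials in the generators lie in [M] and span the quotient. [P] only has to absorb such terms
    one at a time, so it may be a property that products do not preserve. *)
Lemma quot_free_span (S : set (free_alg K X)) (M P : set (quot_alg S)) :
  M 1 -> (forall u v, M u -> M v -> M (u * v)) ->
  (forall a, M (quot_pi S (free_gen K a))) ->
  P 0 -> (forall k u v, M u -> P v -> P (k *: u + v)) -> forall u, P u.
Proof.
move=> M1 MM Mgen P0 PD u; rewrite -[u]quot_reprK (free_algE (quot_repr u)).
elim: (enum_fset _) => [|m s IH]; first by rewrite big_nil rmorph0.
rewrite big_cons rmorphD /= quot_piZ; apply: PD => //; rewrite rmorph_prod.
elim: (fmonom_val m) => [|a t IHt]; first by rewrite big_nil.
by rewrite big_cons; apply: MM; [exact: Mgen|].
Qed.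

Section Eval.
Variables (B : pzRingType) (kappa : {rmorphism K -> B}) (f : X -> B).
Hypothesis kappaC : forall k b, kappa k * b = b * kappa k.

(** Substitution of [f] for the variables. Centrality of the scalars makes it multiplicative; it is
    an argument so that the morphism structures below can use it. *)
Definition free_eval (_ : forall k b, kappa k * b = b * kappa k) (u : F) : B :=
  \sum_(m <- msupp u) kappa u@_m * \prod_(a <- m) f a.
Local Notation ev := (free_eval kappaC).

Lemma free_evalEw (d : {fset {fmonom X}}) (u : F) : (msupp u `<=` d)%fset ->
  ev u = \sum_(m <- d) kappa u@_m * \prod_(a <- m) f a.
Proof.
move=> le; rewrite /free_eval (big_fset_incl _ le) => //= x xd /mcoeff_outdom ->.
by rewrite rmorph0 mul0r.
Qed.

Lemma free_evalU (k : K) (m : {fmonom X}) :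
  ev << k *g m >> = kappa k * \prod_(a <- m) f a.
Proof. by rewrite (free_evalEw msuppU_le) big_seq_fset1 mcoeffUU. Qed.

Lemma free_eval_gen a : ev (free_gen K a) = f a.
Proof. by rewrite free_evalU rmorph1 mul1r fmU big_seq1. Qed.

Lemma free_eval_zmod_morphism : zmod_morphism ev.
Proof.
move=> u v /=; have uu := fsubsetUl (msupp u) (msupp v).
have vu := fsubsetUr (msupp u) (msupp v).
rewrite (free_evalEw uu) (free_evalEw vu) (free_evalEw (msuppB_le u v)).
by rewrite -sumrB; apply: eq_bigr => m _; rewrite mcoeffB rmorphB mulrBl.
Qed.

HB.instance Definition _ :=
  GRing.isZmodMorphism.Build F B ev free_eval_zmod_morphism.

Lemma free_eval_monoid_morphism : monoid_morphism ev.
Proof.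
split; first by rewrite free_evalU rmorph1 mul1r fm1 big_nil.
move=> u v; rewrite [u * v](@malgME _ K) raddf_sum mulr_suml /=.
apply: eq_bigr => i _; rewrite raddf_sum mulr_sumr /=; apply: eq_bigr => j _.
rewrite free_evalU rmorphM fmM big_cat -!mulrA; congr (_ * _).
by rewrite !mulrA kappaC.
Qed.

HB.instance Definition _ :=
  GRing.isMonoidMorphism.Build F B ev free_eval_monoid_morphism.

Lemma free_evalZ k u : ev (k *: u) = kappa k * ev u.
Proof.
rewrite (free_evalEw (msuppZ_le _ _)) /free_eval mulr_sumr.
by apply: eq_bigr => m _; rewrite (mcoeffZ k u) rmorphM mulrA.
Qed.

End Eval.
End FreeAlgebraMorphisms.

(** * Reflections of finite unitary groups *)

Lemma raddf_fsum (U V : zmodType) (f : {additive U -> V}) (I : choiceType)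
    (D : set I) (F : I -> U) : finite_set D ->
  f (\sum_(i \in D) F i) = \sum_(i \in D) f (F i).
Proof. by move=> Dfin; rewrite !fsbig_finite// raddf_sum. Qed.

Lemma mulr_fsumr_fin (B : pzRingType) (I : choiceType) (D : set I) (b : B)
    (F : I -> B) : finite_set D ->
  b * (\sum_(i \in D) F i) = \sum_(i \in D) b * F i.
Proof. by move=> Dfin; rewrite !fsbig_finite// mulr_sumr. Qed.

(** Serves to merge the sums over the reflections of each hyperplane into one sum over all
    reflections. *)
Lemma fsbig_fibers (B : zmodType) (I J : choiceType) (D : set I) (h : I -> J)
    (F : I -> B) : finite_set D ->
  \sum_(j \in h @` D) \sum_(i \in [set i | D i /\ h i = j]) F i
    = \sum_(i \in D) F i.
Proof.
move=> Dfin; have hDfin : finite_set (h @` D) by exact: finite_image.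
under eq_fsbigr => j _.
  rewrite (_ : [set i | D i /\ h i = j] = D `&` (h @^-1` [set j]))//.
  rewrite fsbig_mkcondr; over.
rewrite exchange_fsbig//; apply: eq_fsbigr => i /set_mem Di.
rewrite (fsbigD1 (h i)) ?mem_set//=; last by exists i.
rewrite fsbig1 ?addr0// => j [_ ji].
by rewrite ifF//; apply/negP; rewrite inE/= => /esym.
Qed.

Section UnitaryGroups.
Variables (R : realType) (n : nat).
Local Notation C := R[i].
Implicit Types (W : set 'M[C]_n) (g h : 'M[C]_n) (x : 'rV[C]_n) (y v : 'cV[C]_n).

Definition unitary g := (map_mx Num.conj g)^T *m g = 1%:M.

Definition finite_unitary_group W :=
  [/\ is_subgroup W, finite_set W & forall g, W g -> unitary g].

Lemma unitary_unit g : unitary g -> g \in unitmx.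
Proof. by move=> /mulmx1_unit[]. Qed.

Lemma unitaryV g : unitary g -> invmx g = (map_mx Num.conj g)^T.
Proof.
by move=> gu; rewrite -[RHS]mulmx1 -(mulmxV (unitary_unit gu)) mulmxA gu mul1mx.
Qed.

(** The coefficient of [gamma W c H] in the commutator of [y] and [x]. *)
Definition proj_coef (H : set 'cV[C]_n) y x : C :=
  pairing (hyperplane_form H) y * pairing x (normal_vector H)
    / pairing (hyperplane_form H) (normal_vector H).

(** The columns of [cokermx B] lie in the kernel of [B], so [A] kills them. *)
Lemma kernel_submx m1 m2 (A : 'M[C]_(m1, n)) (B : 'M[C]_(m2, n)) :
  (forall y : 'cV_n, B *m y = 0 -> A *m y = 0) -> (A <= B)%MS.
Proof.
move=> BA; rewrite submxE; apply/eqP/matrixP => i j; set k := cokermx _.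
suff : col j (A *m k) = 0 by move/matrixP/(_ i 0); rewrite !mxE.
by rewrite colE -mulmxA -colE BA// colE mulmxA mulmx_coker mul0mx.
Qed.

Lemma fixed_spaceE g y : fixed_space g y <-> (g - 1%:M) *m y = 0.
Proof.
rewrite mulmxBl mul1mx; split=> [->|/eqP]; first by rewrite subrr.
by rewrite subr_eq0 => /eqP.
Qed.

Lemma submx_fixed_space g h :
  (h - 1%:M <= g - 1%:M)%MS -> fixed_space g `<=` fixed_space h.
Proof.
by move=> /submxP[M hM] y /fixed_spaceE gy; apply/fixed_spaceE;
  rewrite hM -mulmxA gy mulmx0.
Qed.

(** The row space of [h - 1] lies in that of [g - 1], which is a line; as [h] is not 1 the two
    coincide, and so do the kernels. *)
Lemma reflection_fixed_space W g h : reflections W g -> W h -> h <> 1%:M ->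
  fixed_space g `<=` fixed_space h ->
  reflections W h /\ fixed_space h = fixed_space g.
Proof.
move=> [Wg rg] Wh h1 gh.
have hg : (h - 1%:M <= g - 1%:M)%MS.
  by apply: kernel_submx => y /fixed_spaceE/gh/fixed_spaceE.
have rh : \rank (h - 1%:M) = 1%N.
  apply/eqP; rewrite eqn_leq -{1}rg mxrankS//= lt0n mxrank_eq0 subr_eq0.
  exact/eqP.
split=> //; apply/seteqP; split=> //; apply: submx_fixed_space.
by have := mxrank_leqif_eq hg; rewrite rg rh => /leqif_refl/andP[].
Qed.

Lemma dual_formZ a v : dual_form (a *: v) = Num.conj a *: dual_form v.
Proof. by apply/matrixP => i j; rewrite !mxE rmorphM. Qed.

Lemma dual_formM h v : unitary h -> dual_form (h *m v) = dual_form v *m invmx h.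
Proof. by move=> hu; rewrite /dual_form map_mxM trmx_mul unitaryV. Qed.

Lemma dual_form_eq0 v : (dual_form v == 0) = (v == 0).
Proof. by rewrite /dual_form trmx_eq0 map_mx_eq0. Qed.

Lemma pairing_eq0 x y : pairing x y = 0 <-> x *m y = 0.
Proof.
rewrite /pairing; split=> [xy|->]; last by rewrite mxE.
by apply/matrixP => i j; rewrite !ord1 xy mxE.
Qed.

Lemma pairingZl a x y : pairing (a *: x) y = a * pairing x y.
Proof. by rewrite /pairing -scalemxAl mxE. Qed.

Lemma pairingZr a x y : pairing x (a *: y) = a * pairing x y.
Proof. by rewrite /pairing -scalemxAr mxE. Qed.

Definition is_normal g v :=
  v != 0 /\ forall y, fixed_space g y -> pairing (dual_form v) y = 0.

(** The conjugate transpose of a nonzero row of [g - 1] is a normal vector, so the choice made in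
    [normal_vector] does not fall back on its default 0. *)
Lemma normal_vectorP g : \rank (g - 1%:M) = 1%N ->
  is_normal g (normal_vector (fixed_space g)).
Proof.
move=> rg; apply: (@xgetPex _ 0 (is_normal g)).
have [i gi0] : exists i, row i (g - 1%:M) != 0.
  apply/existsP; apply: contraTT isT => /existsPn g0.
  suff g1 : g - 1%:M = 0 by rewrite g1 mxrank0 in rg.
  by apply/row_matrixP => i; rewrite row0; have := g0 i; rewrite negbK => /eqP.
pose v := (map_mx Num.conj (row i (g - 1%:M)))^T.
have vE : dual_form v = row i (g - 1%:M).
  by apply/matrixP => j k; rewrite !mxE conjCK.
exists v; split; first by rewrite -dual_form_eq0 vE.
move=> y /fixed_spaceE gy; apply/pairing_eq0.
by rewrite vE -row_mul gy row0.
Qed.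

(** Both dual forms lie in the row space of [g - 1], which is a line. *)
Lemma normal_unique g v v' : \rank (g - 1%:M) = 1%N ->
  is_normal g v -> is_normal g v' -> exists2 a, a != 0 & v' = a *: v.
Proof.
move=> rg.
have sub u : is_normal g u -> (dual_form u <= g - 1%:M)%MS.
  move=> [_ gu]; apply: kernel_submx => y /fixed_spaceE/gu.
  by move/pairing_eq0.
move=> gv gv'; have [v0 _] := gv; have [v'0 _] := gv'.
have rv : \rank (dual_form v) = 1%N by rewrite rank_rV dual_form_eq0 v0.
have gdv : (g - 1%:M <= dual_form v)%MS.
  by have := mxrank_leqif_eq (sub _ gv); rewrite rg rv => /leqif_refl/andP[].
have /sub_rVP[a va] := submx_trans (sub _ gv') gdv.
have a0 : a != 0.
  by apply: contraNneq v'0 => a0; rewrite -dual_form_eq0 va a0 scale0r.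
exists (Num.conj a); first by rewrite conjC_eq0.
apply/matrixP => i j; rewrite (ord1 j); move/matrixP/(_ 0 i): va.
rewrite !mxE => /(congr1 Num.conj); rewrite rmorphM conjCK => ->.
congr (_ * _); exact: conjCK.
Qed.

(** Rescaling the normal vector by [a] multiplies numerator and denominator alike by [a] times its
    conjugate. *)
Lemma proj_coef_normal g v y x : \rank (g - 1%:M) = 1%N -> is_normal g v ->
  proj_coef (fixed_space g) y x
    = pairing (dual_form v) y * pairing x v / pairing (dual_form v) v.
Proof.
move=> rg gv; have [a a0 va] := normal_unique rg gv (normal_vectorP rg).
have ca0 : Num.conj a != 0 by rewrite conjC_eq0.
rewrite /proj_coef /hyperplane_form va dual_formZ !pairingZl !pairingZr.
rewrite (mulrACA _ _ a) (mulrA _ a) invfM [LHS]mulrACA.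
by rewrite divff ?mul1r ?mulf_neq0.
Qed.

Lemma rank_conj g h : h \in unitmx ->
  \rank (h *m g *m invmx h - 1%:M) = \rank (g - 1%:M).
Proof.
move=> hU; rewrite -[X in _ - X](mulmxV hU) -mulmxBl -[X in _ - X]mulmx1.
by rewrite -mulmxBr mxrankMfree ?row_free_unit ?unitmx_inv// eqmxMfull
  ?row_full_unit.
Qed.

(** By unitarity [h] carries a normal vector for [g] to one for the conjugate of [g], and the three
    pairings are preserved. *)
Lemma proj_coef_conj g h y x : \rank (g - 1%:M) = 1%N -> unitary h ->
  proj_coef (fixed_space (h *m g *m invmx h)) (h *m y) (x *m invmx h)
    = proj_coef (fixed_space g) y x.
Proof.
move=> rg hu; have hU := unitary_unit hu.
have rhg : \rank (h *m g *m invmx h - 1%:M) = 1%N by rewrite rank_conj.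
have gv := normal_vectorP rg; set v := normal_vector _ in gv.
have hgv : is_normal (h *m g *m invmx h) (h *m v).
  have [v0 vP] := gv; split.
    by apply: contraNneq v0 => hv; rewrite -[v](mulKmx hU) hv mulmx0.
  move=> z hgz; rewrite dual_formM// /pairing -mulmxA; apply: vP.
  by rewrite /fixed_space/= -[in RHS](_ : h *m g *m invmx h *m z = z)// -!mulmxA mulKmx.
rewrite (proj_coef_normal _ _ rhg hgv) (proj_coef_normal _ _ rg gv).
by rewrite dual_formM// /pairing -!mulmxA !(mulKmx hU).
Qed.

Lemma reflection_conj W g h : unitary h ->
  (forall k, W k -> W (h *m k *m invmx h)) ->
  reflections W g -> reflections W (h *m g *m invmx h).
Proof.
move=> hu hW [Wg rg]; split; first exact: hW.
by rewrite rank_conj// unitary_unit.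
Qed.

Lemma finite_reflections W : finite_set W -> finite_set (reflections W).
Proof. by apply: sub_finite_set => g []. Qed.

End UnitaryGroups.

(** * Presentation of the rational Cherednik algebra *)

Lemma mulr_conjK (A : pzRingType) (a b a' : A) : a' * a = 1 ->
  a * b * a' * a = a * b.
Proof. by move=> a'a; rewrite -mulrA a'a mulr1. Qed.

Section CherednikModels.
Variables (R : realType) (n : nat).
Local Notation C := R[i].
Variables (W : set 'M[C]_n) (c : 'M[C]_n -> C).
Hypothesis Wgrp : finite_unitary_group W.
Local Notation F := (cherednik_free W).
Local Notation rel := (@cherednik_rel R n W c).
Local Notation H := (cherednik W c).
Implicit Types (g h : 'M[C]_n) (x : 'rV[C]_n) (y : 'cV[C]_n).

(** Indexing by all matrices, with value 0 outside [W], avoids membership proofs in products and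
    gives the zero entries of the induced matrices below. *)
Definition ch_hat g : H := oapp (@ch_w R n W c) 0 (insub g : option W).

Lemma ch_hatE (w : W) : ch_hat (set_val w) = ch_w c w.
Proof. by rewrite /ch_hat valK. Qed.

Lemma ch_hat_elt g (Wg : W g) : ch_hat g = ch_w c (elt Wg).
Proof. by rewrite -ch_hatE. Qed.

Lemma ch_hat_out g : ~ W g -> ch_hat g = 0.
Proof. by move=> Wg; rewrite /ch_hat insubF//; apply/negP => /set_mem. Qed.

Lemma finite_subtype (D : set W) : finite_set D.
Proof.
have [_ Wfin _] := Wgrp.
apply: (@sub_finite_set _ _ (set_val @^-1` W)); first by move=> w _; exact: set_valP.
by apply: finite_preimage => // w w' _ _; exact: val_inj.
Qed.

Lemma cherednik_span (M P : set H) :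
  M 1 -> (forall u v, M u -> M v -> M (u * v)) ->
  (forall x, M (ch_x W c x)) -> (forall y, M (ch_y W c y)) ->
  (forall g, W g -> M (ch_hat g)) ->
  P 0 -> (forall k u v, M u -> P v -> P (k *: u + v)) -> forall u, P u.
Proof.
move=> M1 MM Mx My Mw P0 PD.
apply: (@quot_free_span _ _ _ M P M1 MM _ P0 PD).
case=> [[x|y]|w].
- exact: Mx.
- exact: My.
- by have := Mw _ (set_valP w); rewrite ch_hatE.
Qed.

Section Relations.
Variables (B : pzRingType) (kappa : {rmorphism C -> B}).
Variables (fx : 'rV[C]_n -> B) (fy : 'cV[C]_n -> B) (fw : 'M[C]_n -> B).

Lemma cherednik_free_eval : (forall k b, kappa k * b = b * kappa k) ->
  exists ev : {rmorphism F -> B},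
    [/\ forall k u, ev (k *: u) = kappa k * ev u,
        forall x, ev (free_x W x) = fx x, forall y, ev (free_y W y) = fy y
      & forall w, ev (free_w w) = fw (set_val w)].
Proof.
move=> kappaC.
pose f (a : ('rV[C]_n + 'cV[C]_n + W)%type) :=
  match a with
  | inl (inl x) => fx x | inl (inr y) => fy y | inr w => fw (set_val w)
  end.
exists (free_eval f kappaC).
by split=> [k u|x|y|w]; [exact: free_evalZ|exact: free_eval_gen..].
Qed.

(** Otherwise unification unfolds the free algebra, and diverges. *)
#[local] Opaque cherednik_free free_x free_y free_w.

(** The relation for [y x - x y] is written as a single sum over reflections:
    [g != 1] belongs to the stabilizer of exactly one hyperplane, its fixed
    space, and only if it is a reflection. *)
Record cherednik_model : Prop := CherednikModel {
  model_xP : forall k x x', fx (k *: x + x') = kappa k * fx x + fx x';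
  model_yP : forall k y y', fy (k *: y + y') = kappa k * fy y + fy y';
  model_w1 : fw 1%:M = 1;
  model_wM : forall g h, W g -> W h -> fw (g *m h) = fw g * fw h;
  model_xx : forall x x', fx x * fx x' = fx x' * fx x;
  model_yy : forall y y', fy y * fy y' = fy y' * fy y;
  model_wx : forall g x, W g -> fw g * fx x = fx (x *m invmx g) * fw g;
  model_wy : forall g y, W g -> fw g * fy y = fy (g *m y) * fw g;
  model_yx : forall y x, fy y * fx x - fx x * fy y
    = kappa (pairing x y)
      + \sum_(g \in reflections W)
          kappa (proj_coef (fixed_space g) y x * c g) * fw g }.

Lemma reflection_sum (phi : {rmorphism F -> B}) :
  (forall k u, phi (k *: u) = kappa k * phi u) ->
  (forall w, phi (free_w w) = fw (set_val w)) ->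
  forall y x, phi ((pairing x y)%:A
    + \sum_(H \in hyperplanes W) proj_coef H y x *: gamma W c H)
  = kappa (pairing x y) + \sum_(g \in reflections W)
          kappa (proj_coef (fixed_space g) y x * c g) * fw g.
Proof.
move=> phiZ phiw y x; have [_ Wfin _] := Wgrp.
have rfin := finite_reflections Wfin.
rewrite rmorphD phiZ rmorph1 mulr1; congr (_ + _).
rewrite raddf_fsum; last exact: finite_image.
(* Group the reflections by their fixed hyperplane. *)
rewrite -[RHS](@fsbig_fibers _ _ _ _ (@fixed_space R n))//.
apply: eq_fsbigr => K /set_mem[g0 Wg0 <-{K}].
rewrite /= phiZ raddf_fsum; last exact: finite_subtype.
rewrite mulr_fsumr_fin; last exact: finite_subtype.
(* [set_val] maps the nontrivial elements of the stabilizer bijectively onto the reflections with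
   this fixed hyperplane. *)
rewrite [RHS](@reindex_fsbig _ _ _ _ _ (set_val : W -> 'M_n)
  [set g : W | stabilizer (fixed_space g0) g /\ set_val g <> 1%:M]).
  apply: eq_fsbigr => w /set_mem[wst w1].
  have [_ ->] := reflection_fixed_space Wg0 (set_valP w) w1 wst.
  by rewrite /= phiZ phiw [in RHS]rmorphM mulrA.
split=> [w [wst w1]|w w' _ _|g [[Wg rg] gE]].
- exact: reflection_fixed_space Wg0 (set_valP w) w1 wst.
- exact: val_inj.
- exists (elt Wg) => //; split=> [y' /=|/= g1]; first by rewrite -gE.
  by move: rg; rewrite (g1 : g = 1%:M) subrr mxrank0.
Qed.

(** Universal property of the presentation. The target is any ring with central scalars, which
    allows matrices over a Cherednik algebra. *)
Lemma cherednik_lift : (forall k b, kappa k * b = b * kappa k) ->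
    cherednik_model ->
  exists phi : {rmorphism H -> B},
    [/\ forall k u, phi (k *: u) = kappa k * phi u,
        forall x, phi (ch_x W c x) = fx x,
        forall y, phi (ch_y W c y) = fy y
      & forall g, W g -> phi (ch_hat g) = fw g].
Proof.
move=> kappaC [fxP fyP fw1 fwM fxx fyy fwx fwy fyx].
have [ev [evZ evx evy evw]] := cherednik_free_eval kappaC.
(* Each relation is evaluated by composing these rules, so that only values in [B] remain to be
   compared. *)
have evB u v u' v' : ev u = u' -> ev v = v' -> u' = v' -> ev (u - v) = 0.
  by move=> uu vv uv; rewrite rmorphB uu vv uv subrr.
have evM u v u' v' : ev u = u' -> ev v = v' -> ev (u * v) = u' * v'.
  by move=> uu vv; rewrite rmorphM uu vv.
have evD u v u' v' : ev u = u' -> ev v = v' -> ev (u + v) = u' + v'.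
  by move=> uu vv; rewrite rmorphD uu vv.
have evN u v u' v' : ev u = u' -> ev v = v' -> ev (u - v) = u' - v'.
  by move=> uu vv; rewrite rmorphB uu vv.
have evZ' k u u' : ev u = u' -> ev (k *: u) = kappa k * u'.
  by move=> uu; rewrite evZ uu.
have WV (w w' : W) : set_val w *m set_val w' = 1%:M ->
    fw (set_val w) * fw (set_val w') = 1.
  by move=> ww'; rewrite -fwM ?ww' //; exact: set_valP.
have ev0 s : rel s -> ev s = 0.
  case=> {s} [k x x'|k y y'|w w1|w1 w2 w wE|x x'|y y'|w w' x ww'|w w' y ww'|y x].
  - exact: (evB _ _ _ _ (evx _) (evD _ _ _ _ (evZ' _ _ _ (evx _)) (evx _)) (fxP _ _ _)).
  - exact: (evB _ _ _ _ (evy _) (evD _ _ _ _ (evZ' _ _ _ (evy _)) (evy _)) (fyP _ _ _)).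
  - by apply: (evB _ _ _ _ (evw _) (rmorph1 _)); rewrite w1.
  - apply: (evB _ _ _ _ (evw _) (evM _ _ _ _ (evw _) (evw _))).
    by rewrite wE fwM//; exact: set_valP.
  - exact: (evB _ _ _ _ (evM _ _ _ _ (evx _) (evx _)) (evM _ _ _ _ (evx _) (evx _))).
  - exact: (evB _ _ _ _ (evM _ _ _ _ (evy _) (evy _)) (evM _ _ _ _ (evy _) (evy _))).
  - apply: (evB _ _ _ _ (evM _ _ _ _ (evM _ _ _ _ (evw _) (evx _)) (evw _)) (evx _)).
    by rewrite fwx -?mulrA ?WV ?mulr1//; exact: set_valP.
  - apply: (evB _ _ _ _ (evM _ _ _ _ (evM _ _ _ _ (evw _) (evy _)) (evw _)) (evy _)).
    by rewrite fwy -?mulrA ?WV ?mulr1//; exact: set_valP.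
  - apply: (evB _ _ _ _ (evN _ _ _ _ (evM _ _ _ _ (evy _) (evx _))
      (evM _ _ _ _ (evx _) (evy _))) (reflection_sum evZ evw _ _)).
    exact: fyx.
have liftE u : quot_lift ev0 (quot_pi rel u) = ev u by exact: quot_liftE.
exists (quot_lift ev0); split=> [k u|x|y|g Wg].
- rewrite -[u]quot_reprK -quot_piZ; apply: etrans (liftE _) _.
  by apply: etrans (evZ _ _) _; congr (_ * _); apply/esym/liftE.
- exact: etrans (liftE _) (evx _).
- exact: etrans (liftE _) (evy _).
- by rewrite (ch_hat_elt Wg); exact: etrans (liftE _) (evw _).
Qed.

End Relations.

Let pi := quot_pi rel.

Let piP u v u' v' : rel (u - v) -> pi u = u' -> pi v = v' -> u' = v'.
Proof. by move=> /quot_pi_eq uv <- <-. Qed.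

Let piM u v u' v' : pi u = u' -> pi v = v' -> pi (u * v) = u' * v'.
Proof. by move=> <- <-; exact: rmorphM. Qed.

Let piD u v u' v' : pi u = u' -> pi v = v' -> pi (u + v) = u' + v'.
Proof. by move=> <- <-; exact: rmorphD. Qed.

Let piB u v u' v' : pi u = u' -> pi v = v' -> pi (u - v) = u' - v'.
Proof. by move=> <- <-; exact: rmorphB. Qed.

Let piZ k u u' : pi u = u' -> pi (k *: u) = quot_const rel k * u'.
Proof. by move=> <-; rewrite quot_constM -quot_piZ. Qed.

Lemma ch_hatM g h : W g -> W h -> ch_hat (g *m h) = ch_hat g * ch_hat h.
Proof.
have [[_ WM _] _ _] := Wgrp; move=> Wg Wh.
rewrite (ch_hat_elt (WM _ _ Wg Wh)) (ch_hat_elt Wg) (ch_hat_elt Wh).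
apply: (piP (rel_wM _ _) erefl (piM erefl erefl)).
exact: erefl.
Qed.

Lemma ch_hat1 : ch_hat 1%:M = 1.
Proof.
have [[W1 _ _] _ _] := Wgrp; rewrite (ch_hat_elt W1).
exact: (piP (rel_w1 _ (erefl : set_val (elt W1) = 1%:M)) erefl (rmorph1 _)).
Qed.

Lemma ch_hatV g : W g -> ch_hat g * ch_hat (invmx g) = 1.
Proof.
have [[_ _ WV] _ WU] := Wgrp; move=> Wg.
by rewrite -ch_hatM ?mulmxV ?ch_hat1//; [apply/unitary_unit/WU|apply: WV].
Qed.

Lemma ch_hatVr g : W g -> ch_hat (invmx g) * ch_hat g = 1.
Proof.
have [[_ _ WV] _ WU] := Wgrp; move=> Wg.
by rewrite -ch_hatM ?mulVmx ?ch_hat1//; [apply/unitary_unit/WU|apply: WV].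
Qed.

(** The conjugation relations become commutation rules on multiplying by [g] on the right; the other
    rules are relations of the presentation, the last one resummed over reflections. *)
Lemma cherednik_presentation :
  cherednik_model (@quot_const _ _ rel) (ch_x W c) (ch_y W c) ch_hat.
Proof.
have [[_ _ WV] _ WU] := Wgrp.
have mulWV g : W g -> g *m invmx g = 1%:M.
  by move=> Wg; rewrite mulmxV//; apply/unitary_unit/WU.
split=> [k x x'|k y y'||g h|x x'|y y'|g x Wg|g y Wg|y x].
- exact: (piP (rel_xP _ _ _ _ _) erefl (piD (piZ _ erefl) erefl)).
- exact: (piP (rel_yP _ _ _ _ _) erefl (piD (piZ _ erefl) erefl)).
- exact: ch_hat1.
- exact: ch_hatM.
- exact: (piP (rel_xx _ _ _ _) (piM erefl erefl) (piM erefl erefl)).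
- exact: (piP (rel_yy _ _ _ _) (piM erefl erefl) (piM erefl erefl)).
- have <- : ch_hat g * ch_x W c x * ch_hat (invmx g) = ch_x W c (x *m invmx g).
    rewrite (ch_hat_elt Wg) (ch_hat_elt (WV _ Wg)).
    exact: (piP (@rel_wx _ _ _ c (elt Wg) (elt (WV _ Wg)) x (mulWV _ Wg))
      (piM (piM erefl erefl) erefl) erefl).
  exact/esym/mulr_conjK/ch_hatVr.
- have <- : ch_hat g * ch_y W c y * ch_hat (invmx g) = ch_y W c (g *m y).
    rewrite (ch_hat_elt Wg) (ch_hat_elt (WV _ Wg)).
    exact: (piP (@rel_wy _ _ _ c (elt Wg) (elt (WV _ Wg)) y (mulWV _ Wg))
      (piM (piM erefl erefl) erefl) erefl).
  exact/esym/mulr_conjK/ch_hatVr.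
- apply: (piP (rel_yx _ _ _ _) (piB (piM erefl erefl) (piM erefl erefl))).
  apply: (@reflection_sum _ _ _ (quot_pi rel)).
  + by move=> k u; rewrite quot_constM -quot_piZ.
  + by move=> w; rewrite ch_hatE.
Qed.

Lemma cherednik_ind (P : set H) : is_subalg P ->
  (forall x, P (ch_x W c x)) -> (forall y, P (ch_y W c y)) ->
  (forall g, W g -> P (ch_hat g)) -> forall u, P u.
Proof.
move=> Psub Px Py Pw; have [P1 PD PM] := Psub.
exact: (cherednik_span P1 PM Px Py Pw (is_subalg0 Psub) PD).
Qed.

End CherednikModels.

(** * [G(r,p,n)] as the kernel of a character *)

Section ImprimitiveGroupTheory.
Variables (R : realType) (r p n : nat).
Hypothesis r_gt0 : (0 < r)%N.
Local Notation C := R[i].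
Local Notation G := (Gr1n R r n).
Local Notation Gp := (Grpn R r p n).
Implicit Types (g h : 'M[C]_n).

(** If [zeta ^+ k.+1] were 1 with [k.+1 < r], real parts would give cos(2t) = 1, hence sin t = 0,
    for the number t = (k+1) pi / r strictly between 0 and pi. *)
Lemma zeta_prim : r.-primitive_root (zeta R r).
Proof.
apply/andP; split=> //; apply/forallP => -[k kr]; rewrite unity_rootE /=.
have r0 : (r%:R : R) != 0 by rewrite pnatr_eq0 -lt0n.
have [kE|kE] := eqVneq k.+1 r.
  rewrite kE zetaX mulrCA divff// mulr1 mulr_natl cos2pi sin2pi.
  by rewrite eqxx.
apply/eqP; apply/negbTE/eqP; rewrite zetaX => /(congr1 (@complex.Re R))/= c1.
pose t : R := k.+1%:R * (pi / r%:R).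
have sin0 : 0 < sin t.
  apply: sin_gt0_pi; rewrite mulr_gt0 ?divr_gt0 ?pi_gt0 ?ltr0n//=.
  rewrite /t mulrCA gtr_pMr ?pi_gt0// ltr_pdivrMr ?ltr0n// mul1r ltr_nat.
  by rewrite ltn_neqAle kE.
have tE : k.+1%:R * (2 * pi / r%:R) = t *+ 2 by rewrite /t -mulr_natl; ring.
move: c1; rewrite tE cos_mulr2n cos2sin2 => c1.
have : sin t ^+ 2 = 0 by lra.
by move/eqP; rewrite sqrf_eq0 gt_eqF.
Qed.

Lemma Gr1n_unitary g : G g -> unitary g.
Proof.
move=> /(Gr1nP _ r_gt0)[s [d [dr gE]]].
have dd i : Num.conj (d i) * d i = 1.
  rewrite -normCKC; apply/eqP; rewrite sqrp_eq1// -(@pexpr_eq1 _ _ r)//.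
  by rewrite -normrX dr normr1.
apply/matrixP => i j; rewrite !mxE (bigD1 ((s^-1)%g i))//= big1 => [|k].
  by rewrite !mxE !gE permKV eqxx addr0 mulrnAr dd.
by rewrite !mxE gE -(inj_eq (@perm_inj _ s)) permKV => /negbTE->; rewrite rmorph0 mul0r.
Qed.

Lemma finite_Gr1n : finite_set G.
Proof.
pose f (sd : 'S_n * {ffun 'I_n -> 'I_r}) : 'M[C]_n :=
  \matrix_(i, j) (zeta R r ^+ sd.2 i *+ (sd.1 i == j)).
apply: (@sub_finite_set _ _ (f @` setT)); last exact/finite_image/finite_finset.
move=> g /(Gr1nP _ r_gt0)[s [d [dr gE]]].
have /choice[e eP] : forall i, exists k : 'I_r, d i = zeta R r ^+ k.
  by move=> i; have [k ->] := prim_rootP zeta_prim (dr i); exists k.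
exists (s, [ffun i => e i]) => //; apply/matrixP => i j.
by rewrite mxE gE ffunE eP.
Qed.

(** On a monomial matrix each row sum is the only nonzero entry of its row, so this is the product
    of the nonzero entries. *)
Definition row_prod g : C := \prod_i \sum_j g i j.

Lemma row_prodE g (s : 'S_n) (d : 'I_n -> C) :
  (forall i j, g i j = d i *+ (s i == j)) -> row_prod g = \prod_i d i.
Proof.
move=> gE; apply: eq_bigr => i _; rewrite (bigD1 (s i))//= gE eqxx.
by rewrite big1 ?addr0// => j /negbTE ji; rewrite gE eq_sym ji.
Qed.

Lemma row_prodM g h : G g -> G h -> row_prod (g *m h) = row_prod g * row_prod h.
Proof.
move=> /(Gr1nP _ r_gt0)[s [d [dr gE]]] /(Gr1nP _ r_gt0)[s' [d' [dr' hE]]].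
rewrite (row_prodE gE) (row_prodE hE).
rewrite (@row_prodE _ (s * s')%g (fun i => d i * d' (s i))) => [|i j].
  by rewrite big_split; congr (_ * _); rewrite [RHS](reindex_inj (@perm_inj _ s)).
rewrite mxE (bigD1 (s i))//= big1 => [|k ki].
  by rewrite addr0 gE hE eqxx mulr1n permM mulrnAr.
by rewrite gE eq_sym (negbTE ki) mulr0n mul0r.
Qed.

Lemma row_prod_unity g : G g -> row_prod g ^+ r = 1.
Proof.
move=> /(Gr1nP _ r_gt0)[s [d [dr gE]]].
by rewrite (row_prodE gE) -prodrXl big1.
Qed.

Lemma Gr1n_finite_unitary_group : finite_unitary_group G.
Proof.
by split; [exact: Gr1n_subgroup|exact: finite_Gr1n|exact: Gr1n_unitary].
Qed.

Lemma Grpn_subgroup : is_subgroup Gp.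
Proof.
split=> [W [[]]//|g h Wg Wh W WP|g Wg W WP].
- by have [[_ WM _] _] := WP; apply: WM; [apply: Wg|apply: Wh].
- by have [[_ _ WV] _] := WP; apply: WV; apply: Wg.
Qed.

Lemma Grpn_finite_unitary_group : finite_unitary_group Gp.
Proof.
split; first exact: Grpn_subgroup.
- exact: sub_finite_set (Grpn_sub r_gt0) finite_Gr1n.
- by move=> g /(Grpn_sub r_gt0)/Gr1n_unitary.
Qed.

(** * Permutation and diagonal matrices in the group, and the character *)

Section Generators.
Hypothesis n_ge2 : (2 <= n)%N.
Let o0 : 'I_n := Ordinal (ltnW n_ge2).
Let o1 : 'I_n := Ordinal n_ge2.

Definition dmx (a : 'I_n -> C) : 'M[C]_n := diag_mx (\row_j a j).

Lemma dmxM a b : dmx a *m dmx b = dmx (fun j => a j * b j).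
Proof. by rewrite mulmx_diag; congr diag_mx; apply/rowP => j; rewrite !mxE. Qed.

Lemma perm_dmx (s : 'S_n) a :
  perm_mx s *m dmx a = dmx (fun j => a (s j)) *m perm_mx s.
Proof.
rewrite mul_mx_diag mul_diag_mx; apply/matrixP => i j; rewrite !mxE.
by case: eqP => [->|_]; rewrite ?mulr1 ?mul1r ?mulr0 ?mul0r.
Qed.

Lemma S1_dmx : S1 R r n = dmx (fun j => if j == o0 then zeta R r else 1).
Proof. by []. Qed.

(** The permutations whose matrices lie in [Gp] form a group. It contains the adjacent
    transpositions, hence by induction and conjugation every [tperm o0 j], and these generate the
    symmetric group. *)
Lemma Grpn_perm (s : 'S_n) : Gp (perm_mx s).
Proof.
have [G1 GM GV] := Grpn_subgroup.
pose P := [set s : 'S_n | `[<Gp (perm_mx s)>]]%SET.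
have PP t : (t \in P) <-> Gp (perm_mx t) by rewrite inE; split=> /asboolP.
have gP : group_set P.
  apply/group_setP; split=> [|t u /PP Pt /PP Pu]; apply/PP.
    by rewrite perm_mx1.
  by rewrite perm_mxM; apply: GM.
suff : s \in Group gP by move/PP.
suff: <<[set tperm o0 y | y in 'I_n]%SET>>%g \subset Group gP.
  by rewrite gen_tperm => /fintype.subsetP; apply; rewrite inE.
rewrite gen_subG; apply/fintype.subsetP => _ /imsetP[[j jn] _ ->].
elim: j jn => [|j IH] jn.
  by rewrite (_ : Ordinal jn = o0) ?tperm1 ?group1//; apply: val_inj.
have adj : tperm (Ordinal (ltnW jn)) (Ordinal jn) \in Group gP.
  apply/PP => W [Wg]; apply; right; exists (Ordinal jn) => //.
  (* [ord_pred] is reduced modulo [n]; at a nonzero index it is the ordinary predecessor. *)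
  rewrite /Strans /tperm_mx; congr (perm_mx (tperm _ _)); apply: val_inj => /=.
  by rewrite modnDr modn_small// ltnW.
have [j0|j0] := posnP j.
  rewrite (_ : o0 = Ordinal (ltnW jn))//; apply: val_inj; by rewrite /= j0.
have -> : tperm o0 (Ordinal jn)
    = (tperm o0 (Ordinal (ltnW jn)) ^ tperm (Ordinal (ltnW jn)) (Ordinal jn))%g.
  rewrite tpermJ tpermL tpermD// -val_eqE/=; by case: (j) j0.
by apply: groupJ => //; exact: IH.
Qed.

Lemma Grpn_dmx_prod (I : Type) (l : seq I) (P : pred I) (a : I -> 'I_n -> C) :
  (forall i, P i -> Gp (dmx (a i))) ->
  Gp (dmx (fun j => \prod_(i <- l | P i) a i j)).
Proof.
have [G1 GM _] := Grpn_subgroup; move=> aP; elim: l => [|i l IH].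
  rewrite (_ : dmx _ = 1%:M)//; apply/matrixP => j k.
  by rewrite !mxE big_nil.
rewrite (_ : dmx _ = (if P i then dmx (a i) else 1%:M)
    *m dmx (fun j => \prod_(i <- l | P i) a i j)).
  by apply: (GM) => //; case: ifP => // /aP.
case: ifP => Pi; rewrite ?mul1mx ?dmxM; congr diag_mx; apply/rowP => j;
  by rewrite !mxE big_cons Pi.
Qed.

Lemma Grpn_dmxX a k : Gp (dmx a) -> Gp (dmx (fun j => a j ^+ k)).
Proof.
move=> Ga; rewrite (_ : dmx _ = dmx (fun j => \prod_(i < k) a j)).
  exact: Grpn_dmx_prod.
by congr diag_mx; apply/rowP => j; rewrite !mxE prodr_const card_ord.
Qed.

(** For [i != o0], the diagonal of a matrix of determinant 1; together with [S1 ^+ p] these yield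
    all diagonal matrices of [Gp]. *)
Let q (i j : 'I_n) : C :=
  if j == i then zeta R r else if j == o0 then (zeta R r)^-1 else 1.

Let zeta_neq0 : zeta R r != 0.
Proof.
apply/eqP => z0; have /eqP := prim_expr_order zeta_prim.
by rewrite z0 expr0n gtn_eqF// eq_sym oner_eq0.
Qed.

Lemma S1_unitmx : S1 R r n \in unitmx.
Proof. exact/unitary_unit/Gr1n_unitary/S1_Gr1n. Qed.

Let Grpn_q1 : Gp (dmx (q o1)).
Proof.
have [_ GM _] := Grpn_subgroup; pose T : 'M[C]_n := Strans R o1.
have TE : T = perm_mx (tperm o0 o1).
  rewrite /T /Strans /tperm_mx; congr (perm_mx (tperm _ _)); apply: val_inj => /=.
  by rewrite modnn.
(* [invmx S1 *m T *m S1] is a generator. Times [T], it is [invmx S1] times the conjugate of [S1]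
   that has [zeta] at index 1. *)
have -> : dmx (q o1) = invmx (S1 R r n) *m T *m S1 R r n *m T.
  rewrite -[LHS](mulKmx S1_unitmx) -!mulmxA; congr (_ *m _).
  rewrite mulmxA TE S1_dmx perm_dmx dmxM -mulmxA -perm_mxM tperm2 perm_mx1 mulmx1.
  congr diag_mx; apply/rowP => j; rewrite !mxE /q.
  have [->|j1] := eqVneq j o1; first by rewrite tpermR eqxx/= mul1r.
  have [->|j0] := eqVneq j o0; first by rewrite tpermL/= divff.
  by rewrite tpermD 1?eq_sym// mulr1 eq_sym (negbTE j0).
apply: (GM); last by rewrite TE; exact: Grpn_perm.
by move=> W [Wg]; apply; left; right; exists o1.
Qed.

Let Grpn_q i : i != o0 -> Gp (dmx (q i)).
Proof.
have [_ GM _] := Grpn_subgroup; move=> i0; pose s := tperm o1 i.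
(* Conjugation by the transposition of 1 and [i] fixes index 0 and carries [q o1] to [q i]. *)
have -> : dmx (q i) = perm_mx s *m dmx (q o1) *m perm_mx s.
  rewrite perm_dmx -mulmxA -perm_mxM tperm2 perm_mx1 mulmx1; congr diag_mx.
  have s0 : s o0 = o0 by rewrite /s tpermD.
  have si : s i = o1 by rewrite /s tpermR.
  apply/rowP => j; rewrite !mxE /q.
  have -> : (s j == o1) = (j == i) by rewrite -si (inj_eq perm_inj).
  by have -> : (s j == o0) = (j == o0) by rewrite -{1}s0 (inj_eq perm_inj).
by apply: (GM); [apply: GM|] => //; exact: Grpn_perm.
Qed.

(** If the exponents sum to [m * p], the matrix is the [m]-th power of [S1 ^+ p] times the [e i]-th
    powers of the [q i] with [i != o0]; at index 0 this leaves the exponent [e o0]. *)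
Lemma Grpn_diag (e : 'I_n -> nat) : (p %| \sum_i e i)%N ->
  Gp (dmx (fun j => zeta R r ^+ e j)).
Proof.
have [G1 GM _] := Grpn_subgroup; move=> /dvdnP[m me].
rewrite (_ : dmx _ = dmx (fun j => (if j == o0 then zeta R r ^+ p else 1) ^+ m)
   *m dmx (fun j => \prod_(i | i != o0) q i j ^+ e i)); last first.
  rewrite dmxM; congr diag_mx; apply/rowP => j; rewrite !mxE.
  have [->|j0] := eqVneq j o0.
    rewrite -exprM mulnC -me (bigD1 o0)//= exprD -mulrA.
    rewrite -prodrXr -big_split big1 /= ?mulr1// => i i0.
    by rewrite /q eq_sym (negbTE i0) eqxx exprVn mulfV// expf_neq0.
  rewrite expr1n mul1r (bigD1 j)//= /q eqxx big1 ?mulr1// => i /andP[_ ij].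
  by rewrite eq_sym (negbTE ij) (negbTE j0) expr1n.
apply: (GM); last by apply: Grpn_dmx_prod => i /Grpn_q/Grpn_dmxX.
apply: Grpn_dmxX => W [Wg]; apply; left; left => /=.
rewrite S1_dmx; elim: (p) => [|k IH].
  by rewrite expr0; apply/matrixP => i j; rewrite !mxE; case: (i == o0).
rewrite [RHS]exprS -IH [RHS]dmxM; congr diag_mx; apply/rowP => j; rewrite !mxE.
by case: eqP => _; rewrite ?exprS ?mulr1.
Qed.

Variables (xi : C) (m : nat).
Hypotheses (xi_prim : p.-primitive_root xi) (zetaXm : zeta R r ^+ m = xi).

(** Since [zeta ^+ m = xi], this power of the product of entries sends [S1] to [xi] and permutation
    matrices to 1. *)
Definition chi g : C := row_prod g ^+ m.

Lemma chiM g h : G g -> G h -> chi (g *m h) = chi g * chi h.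
Proof. by move=> Gg Gh; rewrite /chi row_prodM// exprMn. Qed.

Lemma chiX g : G g -> chi g ^+ p = 1.
Proof.
move=> /row_prod_unity gr; rewrite /chi.
have [k ->] := prim_rootP zeta_prim gr.
rewrite -[_ ^+ k ^+ m]exprM mulnC exprM zetaXm exprAC (prim_expr_order xi_prim).
exact: expr1n.
Qed.

Lemma chi_S1 : chi (S1 R r n) = xi.
Proof.
rewrite /chi (@row_prodE _ 1%g (fun j => if j == o0 then zeta R r else 1)).
  rewrite (bigD1 o0)//= big1 ?mulr1 ?zetaXm// => i i0.
  by rewrite (negbTE i0).
by move=> i j; rewrite !mxE perm1.
Qed.

Lemma chi1 : chi 1%:M = 1.
Proof.
rewrite /chi (@row_prodE _ 1%g (fun=> 1)) ?big1 ?expr1n// => i j.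
by rewrite mxE perm1.
Qed.

Lemma chi_perm (s : 'S_n) : chi (perm_mx s) = 1.
Proof.
rewrite /chi (@row_prodE _ s (fun=> 1)) ?big1 ?expr1n// => i j.
by rewrite !mxE.
Qed.

Lemma chiV g : G g -> chi g * chi (invmx g) = 1.
Proof.
have [_ _ GV] := Gr1n_subgroup R n r_gt0; move=> Gg.
by rewrite -chiM ?mulmxV ?chi1//; [apply/unitary_unit/Gr1n_unitary|apply: GV].
Qed.

(** One direction is checked on generators. Conversely, [g] is a diagonal matrix with entries
    [zeta ^+ e j] times a permutation matrix, and [chi g] is [xi] to the sum of the [e j], so [p]
    divides that sum. *)
Lemma Grpn_chi g : G g -> Gp g <-> chi g = 1.
Proof.
have [G1 GM GV] := Gr1n_subgroup R n r_gt0.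
move=> Gg; split=> [|chig1].
  suff: Gp `<=` [set h | G h /\ chi h = 1] by move=> /[apply] -[].
  apply: smallest_sub.
    split=> [|h k [Gh h1] [Gk k1]|h [Gh h1]]; split.
    - exact: G1.
    - exact: chi1.
    - exact: GM.
    - by rewrite chiM// h1 k1 mulr1.
    - exact: GV.
    - by have := chiV Gh; rewrite h1 mul1r.
  have GS := S1_Gr1n R n r_gt0.
  have chiT i : chi (Strans R i) = 1 by exact: chi_perm.
  move=> _ [[->|[i _ <-]]|[i _ <-]].
  - have : forall k, G (S1 R r n ^+ k) /\ chi (S1 R r n ^+ k) = xi ^+ k.
      elim=> [|k [Gk ck]]; first by rewrite !expr0 chi1.
      by rewrite !exprS; split; [apply: GM|rewrite chiM// ck chi_S1].
    by move=> /(_ p)[Gk ck]; split=> //; rewrite ck (prim_expr_order xi_prim).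
  - have GT := Strans_Gr1n R i r_gt0; have GSV := GV _ GS.
    split; first by apply: (GM) => //; apply: GM.
    rewrite chiM ?chiM// ?chiT ?mulr1; last exact: GM.
    by rewrite mulrC chiV.
  - by split; [exact: Strans_Gr1n|exact: chiT].
have [s [d [dr gE]]] := (Gr1nP g r_gt0).1 Gg.
have /choice[e eP] : forall i, exists k : 'I_r, d i = zeta R r ^+ k.
  by move=> i; have [k ->] := prim_rootP zeta_prim (dr i); exists k.
have -> : g = dmx (fun j => zeta R r ^+ e j) *m perm_mx s.
  apply/matrixP => i j; rewrite mul_diag_mx !mxE gE eP.
  by case: eqP => _; rewrite ?mulr1 ?mulr0.
have [_ GpM _] := Grpn_subgroup; apply: (GpM); last exact: Grpn_perm.
apply: (@Grpn_diag (fun i => e i)).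
rewrite (prim_order_dvd xi_prim) -zetaXm -exprM mulnC exprM.
rewrite -prodrXr -[X in _ == X]chig1 /chi (row_prodE gE); apply/eqP.
congr (_ ^+ _).
by apply: eq_bigr => i _; rewrite eP.
Qed.

End Generators.

End ImprimitiveGroupTheory.

(** * Twisting, restricting and inducing models *)

Section ModelTransfer.
Variables (R : realType) (n : nat).
Local Notation C := R[i].
Variables (W N : set 'M[C]_n) (c : 'M[C]_n -> C).
Hypotheses (Wgrp : finite_unitary_group W) (Ngrp : is_subgroup N).
Hypotheses (NW : N `<=` W)
  (Nnormal : forall h g, W h -> N g -> N (h *m g *m invmx h)).
Hypothesis c_inv : forall g h, reflections W g -> W h ->
  c (h *m g *m invmx h) = c g.
Hypothesis c_eq0 : forall g, reflections W g -> ~ N g -> c g = 0.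
Variables (B : pzRingType) (kappa : {rmorphism C -> B}).
Hypothesis kappaC : forall k b, kappa k * b = b * kappa k.
Variables (fx : 'rV[C]_n -> B) (fy : 'cV[C]_n -> B) (fw : 'M[C]_n -> B).

(** In the commutator of [y] and [x], [chi] is 1 at the reflections in [N] and [c] is 0 at the
    others; the remaining rules use that [chi] is multiplicative with central values. *)
Lemma twisted_model (chi : 'M[C]_n -> C) :
  chi 1%:M = 1 -> (forall g h, W g -> W h -> chi (g *m h) = chi g * chi h) ->
  (forall g, N g -> chi g = 1) ->
  cherednik_model W c kappa fx fy fw ->
  cherednik_model W c kappa fx fy (fun g => kappa (chi g) * fw g).
Proof.
move=> chi1 chiM chiN [fxP fyP fw1 fwM fxx fyy fwx fwy fyx]; split=> //.
- by rewrite chi1 rmorph1 mul1r.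
- move=> g h Wg Wh; rewrite chiM// fwM// rmorphM -!mulrA; congr (_ * _).
  by rewrite !mulrA kappaC.
- by move=> g x Wg; rewrite -mulrA fwx// !mulrA kappaC.
- by move=> g y Wg; rewrite -mulrA fwy// !mulrA kappaC.
- move=> y x; rewrite fyx; congr (_ + _); apply: eq_fsbigr => g /set_mem Rg.
  have [Ng|Ng] := pselect (N g); first by rewrite chiN// rmorph1 mul1r.
  by rewrite (c_eq0 Rg Ng) mulr0 rmorph0 !mul0r.
Qed.

Lemma reflectionsS : reflections N `<=` reflections W.
Proof. by move=> g [Ng rg]; split=> //; apply: NW. Qed.

Lemma reflections_out g : (reflections W `\` reflections N) g -> c g = 0.
Proof.
move=> [Rg NRg]; apply: c_eq0 => // Ng; apply: NRg; split=> //.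
by have [_] := Rg.
Qed.

(** The reflections lost in passing to [N] have coefficient [c g = 0]. *)
Lemma restricted_model :
  cherednik_model W c kappa fx fy fw -> cherednik_model N c kappa fx fy fw.
Proof.
move=> [fxP fyP fw1 fwM fxx fyy fwx fwy fyx]; split=> //.
- by move=> g h /NW Wg /NW Wh; apply: fwM.
- by move=> g x /NW Wg; apply: fwx.
- by move=> g y /NW Wg; apply: fwy.
- move=> y x; rewrite fyx; congr (_ + _); apply/esym/fsbig_widen.
    exact: reflectionsS.
  by move=> g /reflections_out c0 /=; rewrite c0 mulr0 rmorph0 mul0r.
Qed.

(** * The model on the induced module *)

Section Induced.
Variables (p : nat) (s : 'I_p -> 'M[C]_n).
Hypotheses (sW : forall i, W (s i))
  (s_cover : forall g, W g -> exists i, N (g *m s i))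
  (s_inj : forall i j, N (invmx (s i) *m s j) -> i = j).
Hypothesis fw_out : forall g, ~ N g -> fw g = 0.

Definition induced_const : {rmorphism C -> 'M[B]_p} := scalar_mx \o kappa.
(** Left multiplication in the basis [s i]: g s_j is s_i times s_i^-1 g s_j, while [x] and [y] move
    past s_i at the cost of the action of its inverse. *)
Definition induced_x x : 'M[B]_p := diag_mx (\row_i fx (x *m s i)).
Definition induced_y y : 'M[B]_p := diag_mx (\row_i fy (invmx (s i) *m y)).
Definition induced_w g : 'M[B]_p := \matrix_(i, j) fw (invmx (s i) *m g *m s j).

Lemma induced_constC k A : induced_const k * A = A * induced_const k.
Proof.
rewrite /= -!mulmxE mul_scalar_mx; apply/matrixP => i j; rewrite !mxE.
rewrite (bigD1 j)//= mxE eqxx mulr1n big1 ?addr0// => l /negbTE lj.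
by rewrite mxE lj mulr0.
Qed.

Let Wunit g : W g -> g \in unitmx.
Proof. by have [_ _ WU] := Wgrp; move=> /WU/unitary_unit. Qed.

Let W1 : W 1%:M. Proof. by have [[]] := Wgrp. Qed.
Let WM g h : W g -> W h -> W (g *m h).
Proof. by have [[_ + _] _ _] := Wgrp; apply. Qed.
Let WV g : W g -> W (invmx g).
Proof. by have [[_ _ +] _ _] := Wgrp; apply. Qed.

Lemma induced_model :
  cherednik_model N c kappa fx fy fw ->
  cherednik_model W c induced_const induced_x induced_y induced_w.
Proof.
have [N1 NM NV] := Ngrp; have [_ Wfin WU] := Wgrp.
move=> [fxP fyP fw1 fwM fxx fyy fwx fwy fyx].
have Nmul g h : N g -> N (g *m h) -> N h.
  move=> Ng Ngh; rewrite -[h](mulKmx (Wunit (NW Ng))).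
  by apply: NM => //; apply: NV.
(* For [g] in [N], [h] and [g *m h] are in [N] together, so both sides vanish when [h] is
   outside. *)
have fwMl g h : N g -> fw (g *m h) = fw g * fw h.
  move=> Ng; have [Nh|Nh] := pselect (N h); first exact: fwM.
  rewrite (fw_out Nh) mulr0; apply: fw_out.
  by apply: contra_not Nh; exact: Nmul.
have sU i : s i \in unitmx by exact/Wunit/sW.
have Nsconj i g : N g -> N (invmx (s i) *m g *m s i).
  by move=> Ng; have := Nnormal (WV (sW i)) Ng; rewrite invmxK.
have Nij i j g : N g -> N (invmx (s i) *m g *m s j) -> i = j.
  move=> Ng Nij; apply: s_inj; apply: Nmul (Nsconj i g Ng) _.
  by rewrite -!mulmxA (mulKVmx (sU i)) mulmxA.
have mxA i j k g h : (invmx (s i) *m g *m s k) *m (invmx (s k) *m h *m s j)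
    = invmx (s i) *m (g *m h) *m s j.
  by rewrite -!mulmxA (mulKVmx (sU k)).
split.
- move=> k x x'; rewrite -mulmxE mul_scalar_mx; apply/matrixP => i j.
  rewrite !mxE mulmxDl -scalemxAl fxP; case: (i == j) => //=.
  by rewrite !mulr0n mulr0 addr0.
- move=> k y y'; rewrite -mulmxE mul_scalar_mx; apply/matrixP => i j.
  rewrite !mxE mulmxDr -scalemxAr fyP; case: (i == j) => //=.
  by rewrite !mulr0n mulr0 addr0.
- apply/matrixP => i j; rewrite !mxE mulmx1.
  have [->|ij] := eqVneq i j; first by rewrite mulVmx.
  by apply: fw_out => /s_inj/eqP; rewrite (negbTE ij).
- move=> g h Wg Wh; apply/matrixP => i j; rewrite -mulmxE !mxE.
  (* The sum for the matrix product has at most one nonzero term, at the [k] with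
     [invmx (s i) *m g *m s k] in [N]. *)
  have [k Nk] := s_cover (WM (WV (sW i)) Wg).
  rewrite (bigD1 k)//= big1 => [|l lk].
    by rewrite addr0 !mxE -fwMl// mxA.
  rewrite !mxE (fw_out (g := _ *m s l)) ?mul0r// => Nl.
  move/eqP: lk; apply; apply/esym/s_inj/(Nmul _ _ Nk).
  by rewrite -!mulmxA (mulKVmx (sU k)) !mulmxA.
- by move=> x x'; rewrite -!mulmxE !mulmx_diag; congr diag_mx; apply/rowP => i;
    rewrite !mxE fxx.
- by move=> y y'; rewrite -!mulmxE !mulmx_diag; congr diag_mx; apply/rowP => i;
    rewrite !mxE fyy.
- move=> g x Wg; rewrite -!mulmxE mul_mx_diag mul_diag_mx; apply/matrixP => i j.
  rewrite !mxE; have [Nh|Nh] := pselect (N (invmx (s i) *m g *m s j)); last first.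
    by rewrite (fw_out Nh) mul0r mulr0.
  rewrite (fwx _ _ Nh); congr (fx _ * _).
  rewrite -[X in X *m invmx _](_ : x *m invmx g *m s i *m (invmx (s i) *m g *m s j) = _).
    by rewrite mulmxK//; exact/Wunit/NW.
  by rewrite -!mulmxA (mulKVmx (sU i)) (mulKmx (Wunit Wg)).
- move=> g y Wg; rewrite -!mulmxE mul_mx_diag mul_diag_mx; apply/matrixP => i j.
  rewrite !mxE; have [Nh|Nh] := pselect (N (invmx (s i) *m g *m s j)); last first.
    by rewrite (fw_out Nh) mul0r mulr0.
  rewrite (fwy _ _ Nh); congr (fy _ * _).
  rewrite -[LHS]mulmxA (mulKVmx (sU j)).
  by rewrite mulmxA.
- move=> y x; rewrite -!mulmxE !mulmx_diag; apply/matrixP => i j.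
  rewrite fsbig_finite; last exact: finite_reflections.
  rewrite !mxE summxE.
  under eq_bigr => g _ do rewrite mul_scalar_mx !mxE.
  rewrite -fsbig_finite; last exact: finite_reflections.
  rewrite -mulrnBl fyx.
  have -> : \sum_(g \in reflections W) kappa (proj_coef (fixed_space g) y x * c g)
      * fw (invmx (s i) *m g *m s j)
    = \sum_(g \in reflections N) kappa (proj_coef (fixed_space g) y x * c g)
      * fw (invmx (s i) *m g *m s j).
    apply/esym/fsbig_widen; first exact: reflectionsS.
    by move=> g /reflections_out c0 /=; rewrite c0 mulr0 rmorph0 mul0r.
  (* As [N] is normal, a reflection in [N] contributes nothing off the diagonal. *)
  have [<-|ij] := eqVneq i j; last first.
    rewrite !mulr0n add0r fsbig1// => g [Ng _].
    by rewrite fw_out ?mulr0// => /(Nij _ _ _ Ng)/eqP; rewrite (negbTE ij).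
  rewrite !mulr1n; congr (kappa _ + _).
    by rewrite /pairing -mulmxA (mulKVmx (sU i)).
  (* On the diagonal, conjugation by [s i] permutes the reflections of [N], preserves [c], and
     matches the coefficients for the transported [x] and [y]. *)
  rewrite [RHS](@reindex_fsbig _ _ _ _ _ (fun g => s i *m g *m invmx (s i))
    (reflections N)).
    apply: eq_fsbigr => g /set_mem Rg.
    rewrite (c_inv (reflectionsS Rg) (sW i)); have [_ rg] := Rg.
    rewrite -[in RHS](mulKVmx (sU i) y) -[in RHS](mulmxK (sU i) x).
    rewrite proj_coef_conj//; last exact: WU.
    by congr (_ * fw _); rewrite -!mulmxA mulVmx// mulmx1 mulKmx.
  split=> [g|g h _ _|g].
  + by apply: reflection_conj; [exact: WU|move=> k; exact: Nnormal].
  + move=> /(congr1 (mulmxr (s i))) /=; rewrite !mulmxKV//.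
    by move=> /(congr1 (mulmx (invmx (s i)))); rewrite !mulKmx.
  + move=> Rg; exists (invmx (s i) *m g *m s i).
      have := @reflection_conj _ _ N g (invmx (s i)); rewrite invmxK; apply=> //.
        exact/WU/WV.
      by move=> k; exact: Nsconj.
    by rewrite -!mulmxA mulmxV// mulmx1 mulKVmx.
Qed.

End Induced.
End ModelTransfer.

(** * Subalgebras, fixed points and averages *)

Section Subalgebras.
Variables (K : comNzRingType) (A : algType K) (S : set A).
Local Notation Q := (quot_alg S).

Lemma is_subalg_conj (P : set Q) a b : is_subalg P -> a * b = 1 -> b * a = 1 ->
  is_subalg [set u | P (a * u * b)].
Proof.
move=> [P1 PD PM] ab ba; split=> [|k u v Pu Pv|u v Pu Pv] /=.
- by rewrite mulr1 ab.
- by rewrite mulrDr mulrDl -quot_alg_scalerAr -quot_alg_scalerAl; apply: PD.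
- have -> : a * (u * v) * b = a * u * b * (a * v * b).
    by rewrite -!mulrA (mulrA b a) ba mul1r.
  exact: PM.
Qed.

Lemma is_subalg_fixed (f : Q -> Q) : alg_morphism f ->
  is_subalg [set u | f u = u].
Proof.
move=> [fl [f1 fM]]; split=> //= [k u v fu fv|u v fu fv].
  by rewrite fl fu fv.
by rewrite fM fu fv.
Qed.

Lemma alg_morphism_iter (f : Q -> Q) k : alg_morphism f ->
  alg_morphism (iter k f).
Proof.
move=> [fl [f1 fM]]; elim: k => [|k [IHl [IH1 IHM]]]; first by [].
by split=> [a u v|]; [rewrite /= IHl fl|split=> [|u v]; rewrite /= ?IH1// IHM fM].
Qed.

(** When row [i0] of [f u] has [u] at [i0] and 0 elsewhere, row [i0] of [f u * f v] is [u] times row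
    [i0] of [f v]. *)
Lemma is_subalg_corner p (f : Q -> 'M[Q]_p) (i0 : 'I_p) :
  f 1 = 1 -> (forall u v, f (u * v) = f u * f v) ->
  (forall k u v, f (k *: u + v) = (quot_const S k)%:M * f u + f v) ->
  is_subalg [set u | forall j, f u i0 j = u *+ (i0 == j)].
Proof.
move=> f1 fM fD; split=> /= [j|k u v fu fv j|u v fu fv j].
- by rewrite f1 mxE.
- rewrite fD -mulmxE mul_scalar_mx !mxE fu fv quot_constM.
  by case: (i0 == j) => //=; rewrite !mulr0n scaler0 addr0.
- rewrite fM -mulmxE mxE (bigD1 i0)//= fu eqxx fv big1 => [|l li0].
    by rewrite addr0; case: (i0 == j); rewrite ?mulr0n ?mulr0.
  by rewrite fu eq_sym (negbTE li0) mulr0n mul0r.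
Qed.

End Subalgebras.

Section SubalgebraMorphisms.
Variables (K : comNzRingType) (A B : algType K) (S : set A) (T : set B).
Variable f : quot_alg S -> quot_alg T.
Hypothesis f_morph : alg_morphism f.

Lemma alg_morphism0 : f 0 = 0.
Proof.
have [fl _] := f_morph.
by have := fl (-1) 0 0; rewrite scaler0 addr0 scaleN1r addNr.
Qed.

Lemma alg_morphismZ k u : f (k *: u) = k *: f u.
Proof.
by have [fl _] := f_morph; have := fl k u 0; rewrite !addr0 alg_morphism0 addr0.
Qed.

Lemma is_subalg_preimage (P : set (quot_alg T)) : is_subalg P ->
  is_subalg [set u | P (f u)].
Proof.
have [fl [f1 fM]] := f_morph; move=> [P1 PD PM].
split=> /= [|k u v Pu Pv|u v Pu Pv]; first by rewrite f1.
  by rewrite fl; apply: PD.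
by rewrite fM; apply: PM.
Qed.

Lemma is_subalg_range : is_subalg (range f).
Proof.
have [fl [f1 fM]] := f_morph; split=> [|k _ _ [u _ <-] [v _ <-]|_ _ [u _ <-] [v _ <-]].
- by exists 1.
- by exists (k *: u + v); rewrite ?fl.
- by exists (u * v); rewrite ?fM.
Qed.

End SubalgebraMorphisms.

Lemma iter_eigenvector (K : comNzRingType) (A : algType K) (S : set A)
    (f : quot_alg S -> quot_alg S) a u k :
  alg_morphism f -> f u = a *: u -> iter k f u = a ^+ k *: u.
Proof.
move=> f_morph fu; elim: k => [|k IH]; first by rewrite expr0 scale1r.
by rewrite iterS IH (alg_morphismZ f_morph) fu scalerA exprSr.
Qed.

Section Averages.
Variables (K : fieldType) (A : algType K) (S : set A).
Local Notation Q := (quot_alg S).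
Variables (p : nat) (f : Q -> Q).
Hypotheses (p_neq0 : p%:R != 0 :> K) (f_morph : alg_morphism f).

Definition average (u : Q) : Q := p%:R^-1 *: \sum_(k < p) iter k f u.

Lemma average_fixed u : (forall k : 'I_p, iter k f u = u) -> average u = u.
Proof.
move=> fu; rewrite /average (eq_bigr (fun=> u)) => [|k _]; last exact: fu.
rewrite sumr_const card_ord -scaler_nat scalerA mulVf//.
exact: scale1r.
Qed.

Lemma average0 : average 0 = 0.
Proof.
by apply: average_fixed => k; apply/alg_morphism0/alg_morphism_iter.
Qed.

Lemma averageD k u v : average (k *: u + v) = k *: average u + average v.
Proof.
rewrite /average (eq_bigr (fun i : 'I_p => k *: iter i f u + iter i f v)).
  by rewrite big_split scalerDr -scaler_sumr !scalerA mulrC.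
by move=> i _; have [gl _] := alg_morphism_iter i f_morph; apply: gl.
Qed.

Lemma average_subalgD (P : set Q) k u v : is_subalg P ->
  P (average u) -> P (average v) -> P (average (k *: u + v)).
Proof. by move=> [_ PD _] Pu Pv; rewrite averageD; apply: PD. Qed.

(** The average is a geometric sum times [u]: it vanishes when [a != 1] because [a ^+ p = 1], and is
    a multiple of [u] when [a = 1]. *)
Lemma average_eigenvector (P : set Q) (a : K) u : is_subalg P ->
  f u = a *: u -> a ^+ p = 1 -> (a = 1 -> P u) -> P (average u).
Proof.
move=> Psub fu ap aP.
rewrite /average (eq_bigr (fun k : 'I_p => a ^+ k *: u)) => [|k _]; last first.
  exact: iter_eigenvector.
rewrite -scaler_suml; have [a1|a1] := eqVneq a 1.
  by apply: is_subalgZ => //; apply: is_subalgZ => //; exact: aP.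
have : (a - 1) * \sum_(k < p) a ^+ k = 0 by rewrite -subrX1 ap subrr.
move/eqP; rewrite mulf_eq0 subr_eq0 (negbTE a1)/= => /eqP->.
by rewrite scale0r scaler0; exact: is_subalg0.
Qed.

End Averages.

(** * Invariants *)

Lemma mulr_conj_shuffle (A : pzRingType) (b g b' g' gi : A) : gi * g = 1 ->
  b * g * (b' * g') = b * (g * b' * gi) * (g * g').
Proof. by move=> gig; rewrite -!mulrA (mulrA gi) gig mul1r. Qed.

Section Invariants.
Variables (R : realType) (n r p m : nat) (xi : R[i]) (c : 'M[R[i]]_n -> R[i]).
Hypotheses (hn : (2 <= n)%N) (hr : (1 <= r)%N).
Hypotheses (xi_prim : p.-primitive_root xi) (zetaXm : zeta R r ^+ m = xi).
Hypothesis c_inv : forall g h : 'M[R[i]]_n, reflections (Gr1n R r n) g ->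
  Gr1n R r n h -> c (h *m g *m invmx h) = c g.
Hypothesis c_eq0 : forall g : 'M[R[i]]_n, reflections (Gr1n R r n) g ->
  ~ Grpn R r p n g -> c g = 0.
Local Notation C := R[i].
Local Notation G := (Gr1n R r n).
Local Notation Gp := (Grpn R r p n).
Local Notation H := (cherednik G c).
Local Notation Hp := (cherednik Gp c).
Local Notation hat := (ch_hat G c).
Local Notation hatp := (ch_hat Gp c).
Local Notation chi := (@chi R n m).

Let Ggrp := Gr1n_finite_unitary_group R n hr.
Let Gpgrp := Grpn_finite_unitary_group R p n hr.
Let GpG : Gp `<=` G. Proof. exact: Grpn_sub. Qed.
Let GpP g : G g -> Gp g <-> chi g = 1.
Proof. exact: (Grpn_chi hr hn xi_prim zetaXm). Qed.

Let G1 : G 1%:M. Proof. by have [[]] := Ggrp. Qed.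
Let GM g h : G g -> G h -> G (g *m h).
Proof. by have [[_ + _] _ _] := Ggrp; apply. Qed.
Let GV g : G g -> G (invmx g).
Proof. by have [[_ _ +] _ _] := Ggrp; apply. Qed.

Let GpN g : Gp g -> chi g = 1.
Proof. by move=> Gpg; apply/GpP => //; exact: GpG. Qed.

Lemma Grpn_normal h g : G h -> Gp g -> Gp (h *m g *m invmx h).
Proof.
move=> Gh Gpg; have Gg := GpG Gpg; apply/GpP; first exact: GM (GM Gh Gg) (GV Gh).
by rewrite !(chiM hr) ?(GpN Gpg) ?mulr1 ?(chiV hr)//; [exact: GM|exact: GV].
Qed.

(** Coset representatives: [chi] takes each [p]-th root of unity at exactly one of them. *)
Let s (i : 'I_p) : 'M[C]_n := S1 R r n ^+ i.

Let sG i : G (s i) /\ chi (s i) = xi ^+ i.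
Proof.
rewrite /s; elim: (nat_of_ord i) => [|k [Gk ck]]; first by rewrite !expr0 chi1.
have GS := S1_Gr1n R n hr; rewrite !exprS -mulmxE; split; first exact: GM.
by rewrite (chiM hr)// ck (chi_S1 hn zetaXm).
Qed.

Lemma S1_cover g : G g -> exists i, Gp (g *m s i).
Proof.
move=> Gg; have := chiX hr xi_prim zetaXm (GV Gg).
move=> /(prim_rootP xi_prim)[i gi]; exists i; have [Gs cs] := sG i.
by apply/GpP; [exact: GM|rewrite (chiM hr)// cs -gi (chiV hr)].
Qed.

Lemma S1_inj i j : Gp (invmx (s i) *m s j) -> i = j.
Proof.
have [Gi ci] := sG i; have [Gj cj] := sG j; move=> /GpN.
rewrite (chiM hr)//; last exact: GV.
move=> /(congr1 (fun z => chi (s i) * z)); rewrite mulrA (chiV hr)// mul1r mulr1 ci cj.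
move=> /eqP; rewrite (eq_prim_root_expr xi_prim) !modn_small// => /eqP ij.
exact/esym/val_inj.
Qed.

Lemma tau_exists : exists tau : {rmorphism H -> H},
  [/\ forall k u, tau (k *: u) = k *: tau u,
      forall x, tau (ch_x G c x) = ch_x G c x,
      forall y, tau (ch_y G c y) = ch_y G c y
    & forall g, G g -> tau (hat g) = chi g *: hat g].
Proof.
have pres := cherednik_presentation c Ggrp.
have := twisted_model c_eq0 (@quot_constC _ _ _) (chi1 R n m) (chiM hr m) GpN pres.
move=> /(cherednik_lift Ggrp (@quot_constC _ _ _))[tau [tauZ taux tauy tauw]].
exists tau; split=> // [k u|g Gg]; first by rewrite tauZ quot_constM.
by rewrite tauw// quot_constM.
Qed.

Lemma iota_exists : exists iota : {rmorphism Hp -> H},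
  [/\ forall k u, iota (k *: u) = k *: iota u,
      forall x, iota (ch_x Gp c x) = ch_x G c x,
      forall y, iota (ch_y Gp c y) = ch_y G c y
    & forall g, Gp g -> iota (hatp g) = hat g].
Proof.
have pres := cherednik_presentation c Ggrp.
have := restricted_model GpG c_eq0 pres.
move=> /(cherednik_lift Gpgrp (@quot_constC _ _ _))[iota [iotaZ iotax iotay iotaw]].
by exists iota; split=> // k u; rewrite iotaZ quot_constM.
Qed.

Let p_gt0 : (0 < p)%N := prim_order_gt0 xi_prim.
Let i0 : 'I_p := Ordinal p_gt0.

(** The action on the induced module, used to recover [u] from [iota u]. *)
Lemma rho_exists : exists rho : {rmorphism H -> 'M[Hp]_p},
  [/\ forall k u, rho (k *: u) = (quot_const _ k)%:M * rho u,
      forall x, rho (ch_x G c x) = induced_x (ch_x Gp c) s x,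
      forall y, rho (ch_y G c y) = induced_y (ch_y Gp c) s y
    & forall g, G g -> rho (hat g) = induced_w hatp s g].
Proof.
have [Gpsub _ _] := Gpgrp; have pres := cherednik_presentation c Gpgrp.
have sW i : G (s i) by have [] := sG i.
have := induced_model Ggrp Gpsub GpG Grpn_normal c_inv c_eq0 sW S1_cover S1_inj
  (@ch_hat_out _ _ Gp c) pres.
move=> /(cherednik_lift Ggrp (@induced_constC _ _ _ (@quot_constC _ _ _) p)).
move=> [rho [rhoZ rhox rhoy rhow]].
by exists rho.
Qed.

Lemma cherednik_sub_hat g : Gp g -> cherednik_sub r p c (hat g).
Proof.
move=> Gpg; apply: subalg_genX; right; exists (elt (GpG Gpg)) => //.
exact/esym/ch_hat_elt.
Qed.

Lemma cherednik_sub_x x : cherednik_sub r p c (ch_x G c x).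
Proof. by apply: subalg_genX; left; left; exists x. Qed.

Lemma cherednik_sub_y y : cherednik_sub r p c (ch_y G c y).
Proof. by apply: subalg_genX; left; right; exists y. Qed.

Lemma cherednik_sub_min (P : set H) : is_subalg P ->
  (forall x, P (ch_x G c x)) -> (forall y, P (ch_y G c y)) ->
  (forall g, Gp g -> P (hat g)) -> cherednik_sub r p c `<=` P.
Proof.
move=> Psub Px Py Pw; apply: smallest_sub => // _ [[[x _ <-]|[y _ <-]]|[w Gpw <-]].
- exact: Px.
- exact: Py.
- by rewrite -ch_hatE; exact: Pw.
Qed.

(** * Embedding of the algebra of the subgroup *)

Section Iota.
Variable iota : {rmorphism Hp -> H}.
Hypotheses (iotaZ : forall k u, iota (k *: u) = k *: iota u)
  (iotax : forall x, iota (ch_x Gp c x) = ch_x G c x)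
  (iotay : forall y, iota (ch_y Gp c y) = ch_y G c y)
  (iotaw : forall g, Gp g -> iota (hatp g) = hat g).

Lemma iota_morph : alg_morphism iota.
Proof.
split; last by split; [exact: rmorph1|exact: rmorphM].
by move=> k u v; apply: etrans (rmorphD _ _ _) _; congr (_ + _); apply: iotaZ.
Qed.

(** [u] is the entry of [rho (iota u)] at [(i0, i0)]. The induction carries the whole row, since one
    entry alone is not multiplicative. *)
Lemma iota_inj : injective iota.
Proof.
have [rho [rhoZ rhox rhoy rhow]] := rho_exists.
have s0 : s i0 = 1%:M by rewrite /s expr0.
pose P : set Hp := [set u | forall j, rho (iota u) i0 j = u *+ (i0 == j)].
suff row : forall u, P u.
  move=> u v uv; have := row u i0; rewrite uv row eqxx !mulr1n.
  by move=> ->.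
apply: cherednik_ind.
- apply: (is_subalg_corner (f := fun u => rho (iota u))).
  + by rewrite !rmorph1.
  + by move=> u v; rewrite !rmorphM.
  + move=> k u v; rewrite -rhoZ -rmorphD; congr (rho _).
    by have [+ _] := iota_morph; apply.
- by move=> x j /=; rewrite iotax rhox !mxE s0 mulmx1.
- by move=> y j /=; rewrite iotay rhoy !mxE s0 invmx1 mul1mx.
- move=> g Gpg j /=; rewrite iotaw// rhow; last exact: GpG.
  rewrite mxE s0 invmx1 mul1mx; have [<-|ij] := eqVneq i0 j.
    by rewrite s0 mulmx1.
  (* The entry at [j] is [hatp (g *m s j)], and [s j] is outside [Gp] for [j] other than [i0]. *)
  rewrite ch_hat_out// => Gpgs; move/eqP: ij; apply; apply: S1_inj.
  rewrite s0 invmx1 mul1mx; have [Gs _] := sG j.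
  have Gg := GpG Gpg; apply/GpP => //.
  by have := GpN Gpgs; rewrite (chiM hr)// (GpN Gpg) mul1r.
Qed.

Lemma iota_range : range iota = cherednik_sub r p c.
Proof.
apply/seteqP; split=> [_ [u _ <-]|].
  move: u; pose P : set Hp := [set u | cherednik_sub r p c (iota u)].
  suff : forall u, P u by []; apply: cherednik_ind.
  - by apply: (is_subalg_preimage iota_morph); exact: subalg_gen_is_subalg.
  - by move=> x; rewrite /P /= iotax; exact: cherednik_sub_x.
  - by move=> y; rewrite /P /= iotay; exact: cherednik_sub_y.
  - by move=> g Gpg; rewrite /P /= iotaw//; exact: cherednik_sub_hat.
apply: cherednik_sub_min.
- exact: is_subalg_range iota_morph.
- by move=> x; exists (ch_x Gp c x).
- by move=> y; exists (ch_y Gp c y).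
- by move=> g Gpg; exists (hatp g); rewrite ?iotaw.
Qed.

Lemma iota_identifies : identifies_sub hr iota.
Proof.
split; [exact: iota_morph|exact: iota_inj|exact: iota_range|split=> // w].
by rewrite -!ch_hatE iotaw//; exact: set_valP.
Qed.

End Iota.

(** * The automorphism and its invariants *)

Section Tau.
Variable tau : {rmorphism H -> H}.
Hypotheses (tauZ : forall k u, tau (k *: u) = k *: tau u)
  (taux : forall x, tau (ch_x G c x) = ch_x G c x)
  (tauy : forall y, tau (ch_y G c y) = ch_y G c y)
  (tauw : forall g, G g -> tau (hat g) = chi g *: hat g).

Lemma tau_morph : alg_morphism tau.
Proof.
split; last by split; [exact: rmorph1|exact: rmorphM].
by move=> k u v; apply: etrans (rmorphD _ _ _) _; congr (_ + _); apply: tauZ.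
Qed.

Lemma tau_iter_w k g : G g -> iter k tau (hat g) = chi g ^+ k *: hat g.
Proof.
by move=> Gg; apply: iter_eigenvector; [exact: tau_morph|exact: tauw].
Qed.

(** [tau] fixes the [x] and [y], and multiplies each [hat g] by a [p]-th root of unity. *)
Lemma tau_order h : iter p tau h = h.
Proof.
pose P : set H := [set u | iter p tau u = u].
suff : forall u, P u by apply.
apply: cherednik_ind.
- exact/is_subalg_fixed/alg_morphism_iter/tau_morph.
- by move=> x; rewrite /P /=; elim: (p) => //= k ->.
- by move=> y; rewrite /P /=; elim: (p) => //= k ->.
- by move=> g Gg; rewrite /P /= tau_iter_w// (chiX hr xi_prim zetaXm)// scale1r.
Qed.

Lemma tau_bij : bijective tau.
Proof.
exists (iter p.-1 tau) => h; last by rewrite -iterS prednK// tau_order.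
by rewrite -iterSr prednK// tau_order.
Qed.

Lemma cherednik_sub_tau b : cherednik_sub r p c b -> tau b = b.
Proof.
move: b; apply: (@cherednik_sub_min [set b | tau b = b]) => //=.
- exact/is_subalg_fixed/tau_morph.
- by move=> g Gpg; rewrite tauw ?GpN ?scale1r//; exact: GpG.
Qed.

(** Conjugation by [g] stabilizes the subalgebra, so products of generators
    can be rearranged into this form. *)
Let M : set H :=
  [set u | exists b g, [/\ cherednik_sub r p c b, G g & u = b * hat g]].

(** Conjugation by a unit respects subalgebras, so generators suffice: [x] and [y] go to elements of
    the same kind, and [Gp] is normal. *)
Lemma cherednik_sub_conj b g : G g ->
  cherednik_sub r p c b -> cherednik_sub r p c (hat g * b * hat (invmx g)).
Proof.
move=> Gg; have pres := cherednik_presentation c Ggrp.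
have hV : hat g * hat (invmx g) = 1 by exact: ch_hatV.
have hVr : hat (invmx g) * hat g = 1 by exact: ch_hatVr.
move: b; apply: (@cherednik_sub_min
    [set b | cherednik_sub r p c (hat g * b * hat (invmx g))]) => [|x|y|k Gpk] /=.
- by apply: is_subalg_conj => //; exact: subalg_gen_is_subalg.
- rewrite (model_wx pres)// -mulrA hV mulr1; exact: cherednik_sub_x.
- rewrite (model_wy pres)// -mulrA hV mulr1; exact: cherednik_sub_y.
- rewrite -!(ch_hatM c Ggrp); first last.
  + exact: GpG.
  + exact: Gg.
  + exact: GV.
  + exact/GM/GpG.
  by apply: cherednik_sub_hat; exact: Grpn_normal.
Qed.

Lemma fixed_sub h : (forall k : 'I_p, iter k tau h = h) ->
  cherednik_sub r p c h.
Proof.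
have p_neq0 : p%:R != 0 :> C by rewrite pnatr_eq0 -lt0n.
(* An invariant equals its average, so it suffices that the average of every element lies in the
   subalgebra. *)
move=> fh; rewrite -(average_fixed p_neq0 fh) => {fh}.
have subP : is_subalg (cherednik_sub r p c : set H).
  exact: subalg_gen_is_subalg.
have [B1 BD BM] := subP.
pose P : set H := [set u | cherednik_sub r p c (average p tau u)].
have h1 : hat 1%:M = 1 by exact: (ch_hat1 c Ggrp).
have MB b : cherednik_sub r p c b -> M b.
  move=> Bb; exists b, 1%:M; split=> //.
  by apply: esym; apply: etrans (mulr1 _); congr (_ * _).
suff : forall u, P u by apply.
apply: (@cherednik_span _ _ _ _ M).
- exact: MB.
- move=> _ _ [b [g [Bb Gg ->]]] [b' [g' [Bb' Gg' ->]]].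
  exists (b * (hat g * b' * hat (invmx g))), (g *m g'); split.
  + by apply: BM => //; exact: cherednik_sub_conj.
  + exact: GM.
  + have E : b * hat g * (b' * hat g')
        = b * (hat g * b' * hat (invmx g)) * (hat g * hat g').
      by apply: mulr_conj_shuffle; exact: (ch_hatVr c Ggrp Gg).
    by apply: etrans E _; congr (_ * _); apply: esym; exact: (ch_hatM c Ggrp).
- by move=> x; apply: MB; exact: cherednik_sub_x.
- by move=> y; apply: MB; exact: cherednik_sub_y.
- by move=> g Gg; exists 1, g; rewrite mul1r.
- by rewrite /P /= (average0 p_neq0 tau_morph); exact: is_subalg0.
- move=> k _ v [b [g [Bb Gg ->]]] Pv.
  apply: (average_subalgD tau_morph _ subP _ Pv).
  (* Hence [b * hat g] is an eigenvector of [tau] with eigenvalue [chi g], and it lies in the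
     subalgebra when [chi g = 1]. *)
  have tb : tau b = b by apply: cherednik_sub_tau.
  apply: (average_eigenvector tau_morph subP (a := chi g)).
  + apply: etrans (rmorphM _ _ _) _; rewrite tb (tauw Gg).
    exact/esym/quot_alg_scalerAr.
  + exact (chiX hr xi_prim zetaXm Gg).
  + by move/(GpP Gg) => Gpg; apply: BM => //; exact: cherednik_sub_hat.
Qed.

Lemma cherednik_sub_invariants :
  cherednik_sub r p c = [set h | forall k : 'I_p, iter k tau h = h].
Proof.
apply/seteqP; split=> [h Bh k|h]; last exact: fixed_sub.
by elim: (nat_of_ord k) => //= l ->; exact: cherednik_sub_tau.
Qed.

End Tau.

End Invariants.

Theorem theorem3p4 (R : realType) (n r p : nat) (xi : R[i])
    (c : 'M[R[i]]_n -> R[i])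
    (hn : (2 <= n)%N) (hr : (1 <= r)%N) (hp : (p %| r)%N)
    (hxi : p.-primitive_root xi)
    (c_inv : forall g h : 'M[R[i]]_n, reflections (Gr1n R r n) g ->
       Gr1n R r n h -> c (h *m g *m invmx h) = c g)
    (c_eq0 : forall g : 'M[R[i]]_n, reflections (Gr1n R r n) g ->
       ~ Grpn R r p n g -> c g = 0) :
  exists tau : cherednik (Gr1n R r n) c -> cherednik (Gr1n R r n) c,
    [/\ (* tau is an algebra automorphism with the prescribed values *)
        [/\ alg_morphism tau, bijective tau,
            forall x, tau (ch_x (Gr1n R r n) c x) = ch_x (Gr1n R r n) c x
          & forall y, tau (ch_y (Gr1n R r n) c y) = ch_y (Gr1n R r n) c y],
        tau (ch_w c (elt (S1_Gr1n R n hr)))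
          = xi *: ch_w c (elt (S1_Gr1n R n hr))
          /\ (forall i : 'I_n, (0 < i)%N ->
                tau (ch_w c (elt (Strans_Gr1n R i hr)))
                  = ch_w c (elt (Strans_Gr1n R i hr))),
        (* its powers define an action of Z/pZ *)
        forall h, iter p tau h = h,
        (* H_c(G(r,p,n)) is a subalgebra of H_c(G(r,1,n)) *)
        exists iota : cherednik (Grpn R r p n) c -> cherednik (Gr1n R r n) c,
          identifies_sub hr iota
      & (* and it is the algebra of invariants of Z/pZ *)
        cherednik_sub r p c = [set h | forall k : 'I_p, iter k tau h = h]].
Proof.
have r_gt0 : (0 < r)%N := hr.
(* As [p] divides [r], [xi] is an [r]-th root of unity, hence a power of [zeta]; the exponent [m]
   defines the character. *)
have xi_r : xi ^+ r = 1.
  by apply/eqP; rewrite -(prim_order_dvd hxi).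
have [m /esym zetaXm] := prim_rootP (zeta_prim R hr) xi_r.
have [tau [tauZ taux tauy tauw]] := tau_exists hn hr hxi zetaXm c_eq0.
have [iota [iotaZ iotax iotay iotaw]] := iota_exists hr c_eq0.
exists tau; split.
- split=> //; first exact: tau_morph tauZ.
  exact: (tau_bij hr hxi zetaXm tauZ taux tauy tauw).
- split=> [|i i_gt0]; rewrite -!ch_hat_elt tauw ?(chi_S1 hn zetaXm)//.
  + exact: S1_Gr1n.
  + by rewrite chi_perm scale1r.
  + exact: Strans_Gr1n.
- exact: (tau_order hr hxi zetaXm tauZ taux tauy tauw).
- exists iota.
  exact: (iota_identifies hn hr hxi zetaXm c_inv c_eq0 iotaZ iotax iotay iotaw).
- exact: (cherednik_sub_invariants hn hr hxi zetaXm tauZ taux tauy tauw).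
Qed.
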